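(* Let $p$ be a prime and $C_p$ the cyclic group of order $p$. Let $g:R'\to R''$ be a surjection of commutative rings with $R''$ semilocal. Assume that $z\in R'$ is a unit whenever $g(z)$ is a unit. Let $S''/R''$ be a $C_p$ Galois extension. Then there is a $C_p$ Galois extension $S'/R'$ such that $S'\otimes_{R',g}R''\cong S''$ as $C_p$ Galois extensions of $R''$.
   Context: ''Galois'' is in the sense of Galois extensions of commutative rings (Auslander–Goldman, Chase–Harrison–Rosenberg); isomorphisms of $C_p$ Galois extensions are algebra isomorphisms over the base commuting with the $C_p$-actions. *)

(* Defs.v *)
From HB Require Import structures.
From mathcomp Require Import all_boot all_order all_algebra.
From mathcomp Require Import fingroup cyclic generic_quotient.
From mathcomp Require Import boolp classical_sets functions cardinality.
From mathcomp Require Import zify.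

Set Implicit Arguments.
Unset Strict Implicit.
Unset Printing Implicit Defensive.

Import GRing.Theory.

Local Open Scope classical_set_scope.
Local Open Scope ring_scope.
Local Open Scope quotient_scope.

(* Commutative rings are [comPzRingType]s (the zero ring is allowed), hence
   units are not given by [GRing.unit], which needs a [unitRingType]. *)
Definition invertible (R : comPzRingType) (z : R) : Prop := exists w, z * w = 1.

Definition ideal (R : comPzRingType) (I : set R) : Prop :=
  [/\ I 0, forall x y, I x -> I y -> I (x + y) & forall a x, I x -> I (a * x)].

Definition maximal_ideal (R : comPzRingType) (M : set R) : Prop :=
  [/\ ideal M, ~ M 1
    & forall J : set R, ideal J -> M `<=` J -> ~ J 1 -> J = M].

Definition semilocal (R : comPzRingType) : Prop :=
  finite_set [set M : set R | maximal_ideal M].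

(* A (x)_R B is the quotient of the finite formal sums of pairs (a, b) (lists,
   added by concatenation) by the congruence generated by commutativity,
   biadditivity and R-balancedness. *)
Section Tensor.
Variables (R A B : comPzRingType) (i : {rmorphism R -> A}).
Variable j : {rmorphism R -> B}.

Inductive tensor_eq : seq (A * B) -> seq (A * B) -> Prop :=
| TensorRefl s : tensor_eq s s
| TensorSym s t : tensor_eq s t -> tensor_eq t s
| TensorTrans s t u : tensor_eq s t -> tensor_eq t u -> tensor_eq s u
| TensorCat s s' t t' :
    tensor_eq s s' -> tensor_eq t t' -> tensor_eq (s ++ t) (s' ++ t')
| TensorCatC s t : tensor_eq (s ++ t) (t ++ s)
| Tensor0 b : tensor_eq [:: (0, b)] [::]
| TensorDl a a' b : tensor_eq [:: (a + a', b)] [:: (a, b); (a', b)]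
| TensorDr a b b' : tensor_eq [:: (a, b + b')] [:: (a, b); (a, b')]
| TensorBal r a b : tensor_eq [:: (i r * a, b)] [:: (a, j r * b)].

Definition tensor_rel : rel (seq (A * B)) := fun s t => `[< tensor_eq s t >].

Lemma tensor_rel_equiv : equiv_class_of tensor_rel.
Proof.
split=> [s|s t|t s u].
- by apply/asboolP; exact: TensorRefl.
- by apply/asboolP/asboolP; exact: TensorSym.
- by move=> /asboolP st /asboolP tu; apply/asboolP; exact: TensorTrans tu.
Qed.

Canonical tensor_equiv := EquivRelPack tensor_rel_equiv.

Definition tensor := {eq_quot tensor_equiv}.

HB.instance Definition _ := Choice.on tensor.
HB.instance Definition _ := EqQuotient.on tensor.

Lemma tensorP s t : tensor_eq s t <-> \pi_tensor s = \pi_tensor t.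
Proof.
split=> [st | /eqP]; last by rewrite eqmodE => /asboolP.
by apply/eqP; rewrite eqmodE; apply/asboolP.
Qed.

Lemma tensor_repr s : tensor_eq (repr (\pi_tensor s)) s.
Proof. by apply/tensorP; rewrite reprK. Qed.

Lemma tensor_perm s t : perm_eq s t -> tensor_eq s t.
Proof.
elim: s t => [|x s IHs] t st.
  by move: st; rewrite perm_sym => /perm_nilP ->; exact: TensorRefl.
have /splitPr t12: x \in t by rewrite -(perm_mem st) mem_head.
case: t12 st => t1 t2 st.
have {}st : perm_eq s (t2 ++ t1).
  by rewrite -(perm_cons x) (permPl st) perm_catC.
rewrite -cat1s; apply: TensorTrans (TensorCatC (x :: t2) t1).
exact: (@TensorCat [:: x] [:: x] _ _ (TensorRefl _) (IHs _ st)).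
Qed.

Definition tensor_seq_mul (s t : seq (A * B)) : seq (A * B) :=
  [seq (x.1 * y.1, x.2 * y.2) | x <- s, y <- t].
Local Notation mul := tensor_seq_mul.


Lemma tensor_seq_mulC s t : tensor_eq (mul s t) (mul t s).
Proof.
apply: tensor_perm; rewrite /mul.
elim: s => [|x s IHs]; first by elim: t.
rewrite allpairs_cons perm_sym (perm_allpairs_consr _ _ (fun=> x)).
rewrite perm_cat //; last by rewrite perm_sym.
by under eq_map do rewrite mulrC [X in (_, X)]mulrC.
Qed.

Lemma tensor_seq_mulDl s t u : mul (s ++ t) u = mul s u ++ mul t u.
Proof. exact: allpairs_cat. Qed.

Lemma tensor_seq_mulA s t u : mul s (mul t u) = mul (mul s t) u.
Proof.
elim: s => [|x s IHs] //.
have mulE y v w : mul (y :: v) w = [seq (y.1 * z.1, y.2 * z.2) | z <- w] ++ mul v w.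
  by [].
rewrite !mulE IHs tensor_seq_mulDl; congr (_ ++ _).
rewrite /mul map_allpairs allpairs_mapl.
by apply: eq_allpairs => y z; rewrite !mulrA.
Qed.

Lemma tensor_seq_mul_eql s s' t :
  tensor_eq s s' -> tensor_eq (mul s t) (mul s' t).
Proof.
have mul1E x : mul [:: x] t = [seq (x.1 * z.1, x.2 * z.2) | z <- t].
  by rewrite /mul /= cats0.
have mul2 x y1 y2 :
    (forall z, tensor_eq [:: (x.1 * z.1, x.2 * z.2)]
        [:: (y1.1 * z.1, y1.2 * z.2); (y2.1 * z.1, y2.2 * z.2)]) ->
    tensor_eq (mul [:: x] t) (mul [:: y1; y2] t).
  move=> xy; rewrite -[[:: y1; y2]]cat1s tensor_seq_mulDl !mul1E.
  elim: t {mul1E} => [|z t IHt] /=; first exact: TensorRefl.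
  apply: TensorTrans (TensorCat (xy z) IHt) _; apply: tensor_perm.
  by apply/permP => P; rewrite /= !count_cat /=; lia.
elim=> {s s'}.
- by move=> s; exact: TensorRefl.
- by move=> s s' _; exact: TensorSym.
- by move=> s1 s2 s3 _ s12 _; exact: TensorTrans.
- by move=> s1 s2 t1 t2 _ s12 _ t12; rewrite !tensor_seq_mulDl; exact: TensorCat.
- by move=> s1 s2; rewrite !tensor_seq_mulDl; exact: TensorCatC.
- move=> b; rewrite mul1E /=.
  elim: t {mul1E mul2} => [|z t IHt] /=; first exact: TensorRefl.
  by rewrite mul0r; exact: (TensorCat (Tensor0 _) IHt).
- by move=> a a' b; apply: mul2 => z /=; rewrite mulrDl; exact: TensorDl.
- by move=> a b b'; apply: mul2 => z /=; rewrite mulrDl; exact: TensorDr.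
- move=> r a b; rewrite !mul1E.
  elim: t {mul1E mul2} => [|z t IHt] /=; first exact: TensorRefl.
  by rewrite -!mulrA; exact: (TensorCat (TensorBal _ _ _) IHt).
Qed.

Lemma tensor_seq_mul_eq s s' t t' :
  tensor_eq s s' -> tensor_eq t t' -> tensor_eq (mul s t) (mul s' t').
Proof.
move=> ss' tt'; apply: TensorTrans (tensor_seq_mul_eql _ ss') _.
apply: TensorTrans (tensor_seq_mulC _ _) _.
apply: TensorTrans (tensor_seq_mul_eql _ tt') _.
exact: tensor_seq_mulC.
Qed.

Lemma tensor_seq_mul1 t : mul [:: (1, 1)] t = t.
Proof.
rewrite /mul /= cats0 -[RHS]map_id.
by apply: eq_map => -[a b] /=; rewrite !mul1r.
Qed.

Definition tensor_zero : tensor := \pi_tensor [::].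
Definition tensor_one : tensor := \pi_tensor [:: (1, 1)].
Definition tensor_add (x y : tensor) : tensor := \pi_tensor (repr x ++ repr y).
Definition tensor_opp (x : tensor) : tensor := \pi_tensor (mul [:: (-1, 1)] (repr x)).
Definition tensor_mul (x y : tensor) : tensor := \pi_tensor (mul (repr x) (repr y)).

Lemma tensor_piD s t : tensor_add (\pi_tensor s) (\pi_tensor t) = \pi_tensor (s ++ t).
Proof. by apply/tensorP; apply: TensorCat; exact: tensor_repr. Qed.

Lemma tensor_piN s : tensor_opp (\pi_tensor s) = \pi_tensor (mul [:: (-1, 1)] s).
Proof.
by apply/tensorP; apply: tensor_seq_mul_eq (tensor_repr _); exact: TensorRefl.
Qed.

Lemma tensor_piM s t : tensor_mul (\pi_tensor s) (\pi_tensor t) = \pi_tensor (mul s t).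
Proof. by apply/tensorP; apply: tensor_seq_mul_eq; exact: tensor_repr. Qed.

Lemma tensor_ind (P : tensor -> Prop) : (forall s, P (\pi_tensor s)) -> forall x, P x.
Proof. by move=> Ppi x; rewrite -[x]reprK. Qed.

Lemma tensor_addA : associative tensor_add.
Proof.
elim/tensor_ind=> s; elim/tensor_ind=> t; elim/tensor_ind=> u.
by rewrite !tensor_piD catA.
Qed.

Lemma tensor_addC : commutative tensor_add.
Proof.
elim/tensor_ind=> s; elim/tensor_ind=> t.
by rewrite !tensor_piD; apply/tensorP; exact: TensorCatC.
Qed.

Lemma tensor_add0 : left_id tensor_zero tensor_add.
Proof. by elim/tensor_ind=> s; rewrite tensor_piD. Qed.

Lemma tensor_addN : left_inverse tensor_zero tensor_opp tensor_add.
Proof.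
elim/tensor_ind=> s; rewrite tensor_piN tensor_piD; apply/tensorP.
rewrite -{2}[s]tensor_seq_mul1 -tensor_seq_mulDl.
rewrite -[X in tensor_eq _ X]/(mul [::] s); apply: tensor_seq_mul_eql.
apply: TensorTrans (TensorSym (TensorDl _ _ _)) _.
by rewrite addNr; exact: Tensor0.
Qed.

HB.instance Definition _ := GRing.isZmodule.Build tensor
  tensor_addA tensor_addC tensor_add0 tensor_addN.

Lemma tensor_mulA : associative tensor_mul.
Proof.
elim/tensor_ind=> s; elim/tensor_ind=> t; elim/tensor_ind=> u.
by rewrite !tensor_piM tensor_seq_mulA.
Qed.

Lemma tensor_mulC : commutative tensor_mul.
Proof.
elim/tensor_ind=> s; elim/tensor_ind=> t.
by rewrite !tensor_piM; apply/tensorP; exact: tensor_seq_mulC.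
Qed.

Lemma tensor_mul1 : left_id tensor_one tensor_mul.
Proof. by elim/tensor_ind=> s; rewrite tensor_piM tensor_seq_mul1. Qed.

Lemma tensor_mulDl : left_distributive tensor_mul +%R.
Proof.
elim/tensor_ind=> s; elim/tensor_ind=> t; elim/tensor_ind=> u.
by rewrite /GRing.add /= tensor_piD !tensor_piM tensor_piD tensor_seq_mulDl.
Qed.

HB.instance Definition _ := GRing.Zmodule_isComPzRing.Build tensor
  tensor_mulA tensor_mulC tensor_mul1 tensor_mulDl.

Definition pure_tensor (a : A) (b : B) : tensor := \pi_tensor [:: (a, b)].
Local Notation "a '*t' b" := (pure_tensor a b) (at level 40).

Lemma pure_tensorDl a a' b : (a + a') *t b = a *t b + a' *t b.
Proof. by rewrite [RHS]tensor_piD; apply/tensorP; exact: TensorDl. Qed.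

Lemma pure_tensorDr a b b' : a *t (b + b') = a *t b + a *t b'.
Proof. by rewrite [RHS]tensor_piD; apply/tensorP; exact: TensorDr. Qed.

Lemma pure_tensor_balanced r a b : (i r * a) *t b = a *t (j r * b).
Proof. by apply/tensorP; exact: TensorBal. Qed.

Lemma pure_tensorM a a' b b' : (a *t b) * (a' *t b') = (a * a') *t (b * b').
Proof. by rewrite [LHS]tensor_piM. Qed.

Lemma pure_tensor0l b : 0 *t b = 0.
Proof. by apply: (addrI (0 *t b)); rewrite -pure_tensorDl !addr0. Qed.

Lemma pure_tensor0r a : a *t 0 = 0.
Proof. by apply: (addrI (a *t 0)); rewrite -pure_tensorDr !addr0. Qed.

Lemma pure_tensorNr a b : a *t (- b) = - (a *t b).
Proof. by apply/eqP; rewrite -addr_eq0 -pure_tensorDr addNr pure_tensor0r. Qed.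

Lemma tensor_pi_sum s : \pi_tensor s = \sum_(x <- s) x.1 *t x.2 .
Proof.
elim: s => [|[a b] s IHs]; first by rewrite big_nil.
by rewrite big_cons -IHs [RHS]tensor_piD.
Qed.

Lemma tensor_spanned (x : tensor) :
  exists s : seq (A * B), x = \sum_(y <- s) y.1 *t y.2.
Proof. by exists (repr x); rewrite -tensor_pi_sum reprK. Qed.

Lemma tensor_universal (V : zmodType) (f : A -> B -> V) :
  (forall a a' b, f (a + a') b = f a b + f a' b) ->
  (forall a b b', f a (b + b') = f a b + f a b') ->
  (forall r a b, f (i r * a) b = f a (j r * b)) ->
  exists2 u : {additive tensor -> V}, forall a b, u (a *t b) = f a b
    & forall u' : {additive tensor -> V},
        (forall a b, u' (a *t b) = f a b) -> u' =1 u.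
Proof.
move=> fDl fDr fbal.
pose ev (s : seq (A * B)) := \sum_(x <- s) f x.1 x.2.
have f0 b : f 0 b = 0 by apply: (addrI (f 0 b)); rewrite -fDl !addr0.
have evP s t : tensor_eq s t -> ev s = ev t.
  rewrite /ev; elim=> {s t} //.
  - by move=> s t u _ -> _ ->.
  - by move=> s s' t t' _ ss' _ tt'; rewrite !big_cat /= ss' tt'.
  - by move=> s t; rewrite !big_cat /= addrC.
  - by move=> b; rewrite big_seq1 big_nil f0.
  - by move=> a a' b; rewrite big_seq1 big_cons big_seq1 fDl.
  - by move=> a b b'; rewrite big_seq1 big_cons big_seq1 fDr.
  - by move=> r a b; rewrite !big_seq1 fbal.
pose u0 (x : tensor) := ev (repr x).
have u0E s : u0 (\pi_tensor s) = ev s by apply: evP; exact: tensor_repr.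
have u0D : nmod_morphism u0.
  split=> [|x y]; first by rewrite u0E /ev big_nil.
  elim/tensor_ind: x => s; elim/tensor_ind: y => t.
  by rewrite [X in u0 X]tensor_piD !u0E /ev big_cat.
pose uM := GRing.isNmodMorphism.Build _ _ u0 u0D.
pose u : {additive tensor -> V} := HB.pack u0 uM.
exists u => [a b | u' u'E x]; first by rewrite [LHS]u0E /ev big_seq1.
elim/tensor_ind: x => s; rewrite [RHS]u0E tensor_pi_sum raddf_sum.
by apply: eq_bigr => -[a b] _; rewrite u'E.
Qed.

Definition tensor_inr (b : B) : tensor := 1 *t b.

Lemma tensor_inr_zmod : zmod_morphism tensor_inr.
Proof. by move=> b b'; rewrite /tensor_inr pure_tensorDr pure_tensorNr. Qed.

Lemma tensor_inr_monoid : monoid_morphism tensor_inr.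
Proof. by split=> // b b'; rewrite /tensor_inr pure_tensorM mulr1. Qed.

HB.instance Definition _ :=
  GRing.isZmodMorphism.Build B tensor tensor_inr tensor_inr_zmod.
HB.instance Definition _ :=
  GRing.isMonoidMorphism.Build B tensor tensor_inr tensor_inr_monoid.

(* [tensor_mapl f] is f (x) id; it is only meaningful for R-linear f. *)
Definition tensor_mapl (f : A -> A) (x : tensor) : tensor :=
  \pi_tensor [seq (f y.1, y.2) | y <- repr x].

Section MapLeft.
Variable f : {rmorphism A -> A}.
Hypothesis fi : forall r, f (i r) = i r.

Lemma tensor_mapl_pi s :
  tensor_mapl f (\pi_tensor s) = \pi_tensor [seq (f y.1, y.2) | y <- s].
Proof.
apply/tensorP; move: (repr _) (tensor_repr s) => t; elim=> {s t} /=.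
- by move=> s; exact: TensorRefl.
- by move=> s t _; exact: TensorSym.
- by move=> s t u _ st _; exact: TensorTrans.
- by move=> s s' t t' _ ss' _ tt'; rewrite !map_cat; exact: TensorCat.
- by move=> s t; rewrite !map_cat; exact: TensorCatC.
- by move=> b; rewrite rmorph0; exact: Tensor0.
- by move=> a a' b; rewrite rmorphD; exact: TensorDl.
- by move=> a b b'; exact: TensorDr.
- by move=> r a b; rewrite rmorphM fi; exact: TensorBal.
Qed.

Lemma tensor_mapl_pure a b : tensor_mapl f (a *t b) = f a *t b.
Proof. exact: tensor_mapl_pi. Qed.

Lemma tensor_maplD : {morph tensor_mapl f : x y / x + y}.
Proof.
elim/tensor_ind=> s; elim/tensor_ind=> t.
by rewrite [_ + _]tensor_piD !tensor_mapl_pi map_cat [RHS]tensor_piD.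
Qed.

Lemma tensor_mapl_zmod : zmod_morphism (tensor_mapl f).
Proof.
move=> x y; apply: (addIr (tensor_mapl f y)).
by rewrite -tensor_maplD !addrNK.
Qed.

Lemma tensor_mapl_monoid : monoid_morphism (tensor_mapl f).
Proof.
split=> [|x y]; first by rewrite [LHS]tensor_mapl_pi /= rmorph1.
elim/tensor_ind: x => s; elim/tensor_ind: y => t.
rewrite [_ * _]tensor_piM !tensor_mapl_pi [RHS]tensor_piM /tensor_seq_mul.
congr (\pi_tensor _); rewrite map_allpairs allpairs_mapl allpairs_mapr /=.
by apply: eq_allpairs => y z; rewrite /= rmorphM.
Qed.

Definition tensor_mapl_rmorphism : {rmorphism tensor -> tensor} :=
  HB.pack (tensor_mapl f)
    (GRing.isZmodMorphism.Build _ _ (tensor_mapl f) tensor_mapl_zmod)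
    (GRing.isMonoidMorphism.Build _ _ (tensor_mapl f) tensor_mapl_monoid).

End MapLeft.

End Tensor.

(* A commutative R-algebra, given by its structure map, on which the finite
   group G acts by R-algebra automorphisms. *)
Record galgebra (G : finGroupType) (R : comPzRingType) := GAlgebra {
  galg_ring :> comPzRingType;
  galg_in : {rmorphism R -> galg_ring};
  galg_act : G -> {rmorphism galg_ring -> galg_ring};
  galg_act1 : forall s, galg_act 1%g s = s;
  galg_actM : forall a b s, galg_act (a * b)%g s = galg_act a (galg_act b s);
  galg_act_in : forall a r, galg_act a (galg_in r) = galg_in r
}.

Section GAlgebra.
Variable G : finGroupType.

(* Chase-Harrison-Rosenberg: R is identified with the invariants S^G, and there
   are x_1, ..., x_n, y_1, ..., y_n in S with
   \sum_i x_i a(y_i) = delta_{a,1} for all a in G. *)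
Definition galois (R : comPzRingType) (S : galgebra G R) : Prop :=
  [/\ injective (galg_in S),
      forall s : S, (forall a, galg_act S a s = s) <-> exists r, galg_in S r = s
    & exists (n : nat) (x y : 'I_n -> S),
        forall a : G, \sum_i x i * galg_act S a (y i) = (a == 1%g)%:R].

Definition galgebra_iso (R : comPzRingType) (S T : galgebra G R) : Prop :=
  exists f : {rmorphism S -> T},
    [/\ bijective f, forall r, f (galg_in S r) = galg_in T r
      & forall a s, f (galg_act S a s) = galg_act T a (f s)].

Section BaseChange.
Variables (R1 R2 : comPzRingType) (g : {rmorphism R1 -> R2}).
Variable S : galgebra G R1.

Let act (a : G) := tensor_mapl_rmorphism g (galg_act_in S a).

Lemma base_change_act1 x : act 1%g x = x.
Proof.
elim/tensor_ind: x => s; rewrite [LHS]tensor_mapl_pi; last exact: galg_act_in.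
congr (\pi_(tensor _ _) _); rewrite -[RHS]map_id.
by apply: eq_map => -[u v] /=; rewrite galg_act1.
Qed.

Lemma base_change_actM a b x : act (a * b)%g x = act a (act b x).
Proof.
have actE c s : act c (\pi_(tensor (galg_in S) g) s) =
    \pi_(tensor _ _) [seq (galg_act S c y.1, y.2) | y <- s].
  by apply: tensor_mapl_pi; exact: galg_act_in.
elim/tensor_ind: x => s; rewrite !actE -map_comp.
by congr (\pi_(tensor _ _) _); apply: eq_map => y /=; rewrite galg_actM.
Qed.

Lemma base_change_act_in a r :
  act a (tensor_inr (galg_in S) g r) = tensor_inr (galg_in S) g r.
Proof.
by rewrite [LHS]tensor_mapl_pure ?rmorph1 //; exact: galg_act_in.
Qed.

(* S (x)_{R1,g} R2, an R2-algebra through the right factor, with G acting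
   through the left one. *)
Definition base_change : galgebra G R2 :=
  @GAlgebra G R2 (tensor (galg_in S) g) (tensor_inr (galg_in S) g) act
    base_change_act1 base_change_actM base_change_act_in.

End BaseChange.
End GAlgebra.

(* Main.v *)
(* Write p = n.+2, V = Z/p and lam = zeta - 1.  A symmetric normalized unit cocycle C
   in R[V x V] defines a Galois algebra with normal basis (s_g), in which the
   resolvent w = sum_g s_g [g] satisfies (w (x) 1) (1 (x) w) = C Delta(w).

   Over a ring containing zeta, an element a with 1 + lam^p a invertible gives the
   cocycle 1 + a kappa, where kappa has the carry cocycle of Z/p times lam^p as
   Fourier transform; it is the coboundary of the resolvent attached to any root y of
   ((1 + lam y)^p - 1) / lam^p = a.  These identities hold over Z[zeta][y] because they
   hold after Fourier transform and p is regular there.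

   Given S over R'', trace one elements and the finiteness of the maximal ideals of
   R'' yield y in S (x) Z[zeta] with sigma(y) = zeta y + 1 and 1 + lam y invertible,
   hence such an a in R'' (x) Z[zeta].  Lift a to R' (x) Z[zeta] and take C' to be the
   inverse of the norm of 1 + a kappa from (R' (x) Z[zeta])[V x V] to R'[V x V].  The
   inverse of the norm of the resolvent of y trivializes the image of C' over S, and
   sigma multiplies it by [1], since the norm of [1] is [1]^(p-1) = [-1].  Its
   coefficients are thus a normal basis of S with the multiplication table of C'. *)
Require Import Defs.
From HB Require Import structures.
From mathcomp Require Import all_boot all_order all_algebra.
From mathcomp Require Import fingroup cyclic.
From mathcomp Require Import boolp classical_sets cardinality.
From mathcomp Require Import ring zify.

Set Implicit Arguments.
Unset Strict Implicit.
Unset Printing Implicit Defensive.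

Import GRing.Theory.
Local Open Scope ring_scope.

(** * Group algebras *)

(** The equations of a cocycle do not lift along a surjection, but a parameter [a] subject only to
    the invertibility of 1 + lam^p a does; this is why the extension is first described over
    Z[zeta], where such a parameter exists. The polynomial ((1 + lam y)^p - 1) / lam^p replaces it:
    it becomes y^p - y modulo lam and is equivalent to the Kummer equation where lam is invertible,
    so it covers both kinds of residue field at once. The norm plays the part of corestriction from
    R (x) Z[zeta] to R. After restriction it multiplies classes by the degree p - 1, which is -1 on
    classes killed by p; inverting the norm removes the sign and gives back S itself. Semilocality
    serves to make 1 + lam y invertible. The equation sigma(y) = zeta y + 1 always has a solution,
    and one may add to y any invariant multiple of an element x with sigma(x) = zeta x. Such x,
    multiplied by suitable partners, generate p, which is enough to repair y wherever 1 + lam y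
    vanishes. *)

Section GroupAlgebra.
Variables (R : comPzRingType) (V : finZmodType).

Definition grpalg := {ffun V -> R}.

HB.instance Definition _ := GRing.Zmodule.copy grpalg {ffun V -> R}.

Definition ga_mul (f g : grpalg) : grpalg := [ffun x => \sum_y f y * g (x - y)].
Definition ga_mono (v : V) : grpalg := [ffun x => (x == v)%:R].
Definition ga_scal (r : R) : grpalg := [ffun x => r * (x == 0)%:R].

Lemma ga_mulA : associative ga_mul.
Proof.
move=> f g h; apply/ffunP=> x; rewrite !ffunE.
under eq_bigr do rewrite ffunE mulr_sumr.
under [RHS]eq_bigr do rewrite ffunE mulr_suml.
rewrite [RHS]exchange_big /=; apply: eq_bigr => y _.
rewrite [RHS](reindex_inj (addIr y)) /=; apply: eq_bigr => z _.
by rewrite mulrA addrK opprD addrAC addrA.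
Qed.

Lemma ga_mulC : commutative ga_mul.
Proof.
move=> f g; apply/ffunP=> x; rewrite !ffunE.
rewrite (reindex_inj (inj_comp (addrI x) (@oppr_inj V))) /=.
by apply: eq_bigr => y _; rewrite subKr mulrC.
Qed.

Lemma ga_mulDl : left_distributive ga_mul +%R.
Proof.
move=> f g h; apply/ffunP=> x; rewrite !ffunE -big_split /=.
by apply: eq_bigr => y _; rewrite ffunE mulrDl.
Qed.

Lemma ga_mul_mono v (f : grpalg) : ga_mul (ga_mono v) f = [ffun x => f (x - v)].
Proof.
apply/ffunP=> x; rewrite !ffunE (bigD1 v) //= ffunE eqxx mul1r big1 ?addr0 //.
by move=> y /negPf yv; rewrite ffunE yv mul0r.
Qed.

Lemma ga_mul1 : left_id (ga_mono 0) ga_mul.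
Proof. by move=> f; rewrite ga_mul_mono; apply/ffunP=> x; rewrite ffunE subr0. Qed.

HB.instance Definition _ := GRing.Zmodule_isComPzRing.Build grpalg
  ga_mulA ga_mulC ga_mul1 ga_mulDl.

Lemma gaM (f g : grpalg) x : (f * g) x = \sum_y f y * g (x - y).
Proof. by rewrite [LHS]ffunE. Qed.

Lemma ga1 x : (1 : grpalg) x = (x == 0)%:R.
Proof. by rewrite ffunE. Qed.

Lemma ga_sum I (r : seq I) (P : pred I) (F : I -> grpalg) x :
  (\sum_(i <- r | P i) F i) x = \sum_(i <- r | P i) F i x.
Proof. by rewrite sum_ffunE. Qed.

Lemma ga_monoM v (f : grpalg) x : (ga_mono v * f) x = f (x - v).
Proof. by rewrite [_ * _]ga_mul_mono ffunE. Qed.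

Lemma ga_monoD u v : ga_mono (u + v) = ga_mono u * ga_mono v.
Proof.
by apply/ffunP => x; rewrite ga_monoM !ffunE subr_eq addrC.
Qed.

Lemma ga_mono0 : ga_mono 0 = 1. Proof. by []. Qed.

Lemma ga_scalM r (f : grpalg) x : (ga_scal r * f) x = r * f x.
Proof.
rewrite gaM (bigD1 0) //= ffunE eqxx mulr1 subr0 big1 ?addr0 // => y /negPf y0.
by rewrite ffunE y0 mulr0 mul0r.
Qed.

Lemma ga_scal_zmod : zmod_morphism ga_scal.
Proof. by move=> r s; apply/ffunP=> x; rewrite !ffunE mulrBl. Qed.
Lemma ga_scal_monoid : monoid_morphism ga_scal.
Proof.
split=> [|r s]; apply/ffunP=> x; first by rewrite !ffunE mul1r.
by rewrite ga_scalM !ffunE mulrA.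
Qed.
HB.instance Definition _ := GRing.isZmodMorphism.Build R grpalg ga_scal ga_scal_zmod.
HB.instance Definition _ :=
  GRing.isMonoidMorphism.Build R grpalg ga_scal ga_scal_monoid.

Lemma ga_decomp (f : grpalg) : f = \sum_v ga_scal (f v) * ga_mono v.
Proof.
apply/ffunP=> x; rewrite ga_sum (bigD1 x) //= ga_scalM ffunE eqxx mulr1.
rewrite big1 ?addr0 // => v /negPf vx.
by rewrite ga_scalM ffunE eq_sym vx mulr0.
Qed.

Lemma ga_ext (X : comPzRingType) (F G : {rmorphism grpalg -> X}) :
  (forall r, F (ga_scal r) = G (ga_scal r)) ->
  (forall v, F (ga_mono v) = G (ga_mono v)) -> F =1 G.
Proof.
move=> Fs Fm f; rewrite [f]ga_decomp !rmorph_sum; apply: eq_bigr => v _.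
by rewrite !rmorphM Fs Fm.
Qed.

End GroupAlgebra.

Arguments ga_mono {R V}.
Arguments ga_scal {R V}.

(** A homomorphism from the additive group V to the multiplicative monoid of X: the datum that
    extends a ring map on coefficients to the group algebra. *)
Definition expo_char (V : zmodType) (X : pzRingType) (t : V -> X) :=
  t 0 = 1 /\ forall u v, t (u + v) = t u * t v.

Section Lift.
Variables (R X : comPzRingType) (V : finZmodType).
Variables (h : {rmorphism R -> X}) (t : V -> X).
Hypothesis tchar : expo_char t.

Definition ga_lift_fun (f : grpalg R V) : X := \sum_v h (f v) * t v.

Lemma ga_lift_zmod : zmod_morphism ga_lift_fun.
Proof.
move=> f g; rewrite /ga_lift_fun -sumrB; apply: eq_bigr => v _.
by rewrite !ffunE rmorphB mulrBl.
Qed.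

Lemma ga_lift_monoid : monoid_morphism ga_lift_fun.
Proof.
case: tchar => t0 tD; split=> [|f g]; rewrite /ga_lift_fun.
  rewrite (bigD1 0) //= ffunE eqxx rmorph1 t0 mulr1 big1 ?addr0 // => v /negPf v0.
  by rewrite ffunE v0 rmorph0 mul0r.
rewrite mulr_suml.
under eq_bigr do rewrite gaM rmorph_sum mulr_suml.
rewrite exchange_big /=; apply: eq_bigr => y _; rewrite mulr_sumr.
rewrite (reindex_inj (addIr y)) /=; apply: eq_bigr => x _.
by rewrite addrK rmorphM tD; ring.
Qed.

Fact ga_lift_subproof :
  {F : {rmorphism grpalg R V -> X} | forall f, F f = \sum_v h (f v) * t v}.
Proof.
pose F : {rmorphism grpalg R V -> X} := HB.pack ga_lift_fun
  (GRing.isZmodMorphism.Build _ _ ga_lift_fun ga_lift_zmod)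
  (GRing.isMonoidMorphism.Build _ _ ga_lift_fun ga_lift_monoid).
by exists F.
Qed.

Definition ga_lift := sval ga_lift_subproof.

Lemma ga_liftE f : ga_lift f = \sum_v h (f v) * t v.
Proof. exact: (svalP ga_lift_subproof). Qed.

Lemma ga_lift_scal r : ga_lift (ga_scal r) = h r.
Proof.
case: tchar => t0 _; rewrite ga_liftE (bigD1 0) //= ffunE eqxx mulr1 t0 mulr1.
by rewrite big1 ?addr0 // => v /negPf v0; rewrite ffunE v0 mulr0 rmorph0 mul0r.
Qed.

Lemma ga_lift_mono v : ga_lift (ga_mono v) = t v.
Proof.
rewrite ga_liftE (bigD1 v) //= ffunE eqxx rmorph1 mul1r.
by rewrite big1 ?addr0 // => u /negPf uv; rewrite ffunE uv rmorph0 mul0r.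
Qed.

End Lift.

Section Functor.
Variables (R R' : comPzRingType) (V W : finZmodType).

Lemma ga_map_char (phi : {additive V -> W}) :
  expo_char (fun v => ga_mono (phi v) : grpalg R' W).
Proof. by split=> [|u v]; rewrite ?raddf0 ?ga_mono0 ?raddfD ?ga_monoD. Qed.

Definition ga_map (h : {rmorphism R -> R'}) (phi : {additive V -> W}) :
  {rmorphism grpalg R V -> grpalg R' W} :=
  ga_lift (@ga_scal R' W \o h) (ga_map_char phi).

Lemma ga_map_scal h phi r : ga_map h phi (ga_scal r) = ga_scal (h r).
Proof. exact: ga_lift_scal. Qed.

Lemma ga_map_mono h phi v : ga_map h phi (ga_mono v) = ga_mono (phi v).
Proof. exact: ga_lift_mono. Qed.

Lemma ga_mapE h (phi : {additive V -> W}) f w :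
  ga_map h phi f w = \sum_(v | phi v == w) h (f v).
Proof.
rewrite ga_liftE ga_sum [RHS]big_mkcond; apply: eq_bigr => v _.
by rewrite ga_scalM ffunE eq_sym; case: eqP; rewrite ?mulr1 ?mulr0.
Qed.

End Functor.

Definition ga_coef (R R' : comPzRingType) (V : finZmodType)
  (h : {rmorphism R -> R'}) : {rmorphism grpalg R V -> grpalg R' V} :=
  ga_map h (idfun : {additive V -> V}).

Lemma ga_coefE (R R' : comPzRingType) (V : finZmodType)
  (h : {rmorphism R -> R'}) (f : grpalg R V) v : ga_coef V h f v = h (f v).
Proof. by rewrite ga_mapE /= big_pred1_eq. Qed.

(** * The extension R (x) Z[zeta] and its norm *)

Section Companion.
Variables (n : nat) (R : comPzRingType).

(** Multiplication by zeta on row vectors in the basis 1, ..., zeta^n; the last row encodes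
    zeta^(n+1) = -(1 + ... + zeta^n). *)
Definition comp_mx : 'M[R]_n.+1 :=
  \matrix_(i, j) if (i < n)%N then (j == i.+1 :> nat)%:R else -1.

Lemma comp_mx_exp_row0 k (j : 'I_n.+1) :
  (k <= n)%N -> (comp_mx ^+ k) 0 j = (j == k :> nat)%:R.
Proof.
elim: k j => [|k IHk] j kn.
  by rewrite expr0 !mxE eq_sym -val_eqE.
have kn1 : (k < n.+1)%N by exact: ltnW.
rewrite exprSr mxE (bigD1 (inord k)) //= IHk 1?ltnW // inordK // eqxx mul1r.
rewrite !mxE inordK // kn big1 ?addr0 // => i ik.
rewrite IHk 1?ltnW // (_ : (i == k :> nat) = false) ?mul0r //.
by apply/negbTE; move: ik; rewrite -val_eqE /= inordK.
Qed.

Definition comp_comm : pred 'M[R]_n.+1 := fun x => x * comp_mx == comp_mx * x.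

Lemma comp_commP x : reflect (GRing.comm x comp_mx) (comp_comm x).
Proof. exact: eqP. Qed.

(** Row 0 of [comp_mx ^+ i] is the i-th basis vector, so row i of a commuting matrix z is row 0 of
    [comp_mx ^+ i * z], that is, row 0 of z times [comp_mx ^+ i]. *)
Lemma comp_comm_row0 (x y : 'M[R]_n.+1) :
  comp_comm x -> comp_comm y -> (forall j, x 0 j = y 0 j) -> x = y.
Proof.
move=> /comp_commP cx /comp_commP cy xy; apply/matrixP => i j.
have rowi (z : 'M[R]_n.+1) : GRing.comm z comp_mx ->
    z i j = \sum_k z 0 k * (comp_mx ^+ i) k j.
  move=> cz; transitivity ((comp_mx ^+ i * z) 0 j); last first.
    by rewrite -(commrX i cz) mxE.
  rewrite mxE (bigD1 i) //= comp_mx_exp_row0 -1?ltnS // eqxx mul1r big1 ?addr0 //.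
  by move=> k ki; rewrite comp_mx_exp_row0 -1?ltnS // val_eqE (negPf ki) mul0r.
by rewrite !rowi //; apply: eq_bigr => k _; rewrite xy.
Qed.

Lemma comp_comm_subring : subring_closed comp_comm.
Proof.
split=> [|x y /comp_commP cx /comp_commP cy|x y /comp_commP cx /comp_commP cy].
- by apply/comp_commP/commr_sym/commr1.
- by apply/comp_commP/commr_sym/commrB; exact: commr_sym.
- by apply/comp_commP/commr_sym/commrM; exact: commr_sym.
Qed.

HB.instance Definition _ := GRing.isSubringClosed.Build 'M[R]_n.+1 comp_comm
  comp_comm_subring.

Lemma comp_comm_scalar r : comp_comm r%:M.
Proof. by apply/comp_commP; rewrite /GRing.comm -!mulmxE scalar_mxC. Qed.

Lemma comp_comm_comp : comp_comm comp_mx.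
Proof. exact/comp_commP. Qed.

Lemma comp_comm_poly (v : 'I_n.+1 -> R) : comp_comm (\sum_i (v i)%:M * comp_mx ^+ i).
Proof.
change (\sum_i (v i)%:M * comp_mx ^+ i \in comp_comm).
apply: rpred_sum => i _; apply: rpredM; first exact: comp_comm_scalar.
by apply: rpredX; exact: comp_comm_comp.
Qed.

Lemma scalar_mulmxE r (x : 'M[R]_n.+1) i j : (r%:M * x) i j = r * x i j.
Proof. by rewrite [_ * _]mul_scalar_mx mxE. Qed.

Lemma comp_poly_row0 (v : 'I_n.+1 -> R) j :
  (\sum_i (v i)%:M * comp_mx ^+ i) 0 j = v j.
Proof.
rewrite summxE (bigD1 j) //= scalar_mulmxE comp_mx_exp_row0 -1?ltnS //.
rewrite eqxx mulr1 big1 ?addr0 // => i ij.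
rewrite scalar_mulmxE comp_mx_exp_row0 -1?ltnS //.
by rewrite val_eqE eq_sym (negPf ij) mulr0.
Qed.

Lemma comp_comm_polyE (x : 'M[R]_n.+1) : comp_comm x ->
  x = \sum_i (x 0 i)%:M * comp_mx ^+ i.
Proof.
move=> cx; apply: comp_comm_row0 => // [|j]; last by rewrite comp_poly_row0.
exact: comp_comm_poly.
Qed.

Lemma comp_comm_mulC (x y : 'M[R]_n.+1) :
  comp_comm x -> comp_comm y -> x * y = y * x.
Proof.
move=> /comp_comm_polyE -> /comp_commP cy; rewrite -[LHS]/(_ * y).
apply/commr_sym/commr_sum => i _; apply/commrM.
  by rewrite /GRing.comm -!mulmxE scalar_mxC.
exact: commrX.
Qed.

(** By commutation row 0 suffices: the powers up to n contribute each basis vector once, and the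
    power n + 1 contributes the row of -1. *)
Lemma comp_mx_sum : \sum_(k < n.+2) comp_mx ^+ k = 0.
Proof.
apply: comp_comm_row0 => [||j].
- change (\sum_(k < n.+2) comp_mx ^+ k \in comp_comm).
  by apply: rpred_sum => i _; apply: rpredX; exact: comp_comm_comp.
- exact: rpred0.
rewrite big_ord_recr /= mxE summxE mxE.
have -> : (comp_mx ^+ n.+1) 0 j = -1.
  rewrite exprSr mxE (bigD1 ord_max) //= comp_mx_exp_row0 //= eqxx mul1r.
  rewrite mxE /= ltnn big1 ?addr0 // => k kn.
  rewrite comp_mx_exp_row0 // (_ : (k == n :> nat) = false) ?mul0r //.
  by apply/negbTE; move: kn; rewrite -val_eqE.
rewrite (bigD1 j) //= comp_mx_exp_row0 -1?ltnS // eqxx big1 ?addr0 ?subrr //.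
by move=> i ij; rewrite comp_mx_exp_row0 -1?ltnS // val_eqE eq_sym (negPf ij).
Qed.

(* The matrices commuting with the companion matrix of 1 + X + ... + X^(n+1) are
   the polynomials in it, so for p = n.+2 prime this is R (x) Z[zeta_p].  In this
   model the norm to R is the determinant. *)
Record cyc := Cyc { cyc_mx :> 'M[R]_n.+1; cyc_mxP : comp_comm cyc_mx }.

HB.instance Definition _ := [isSub of cyc for cyc_mx].
HB.instance Definition _ := [Choice of cyc by <:].
HB.instance Definition _ :=
  GRing.SubChoice_isSubPzRing.Build 'M[R]_n.+1 comp_comm cyc comp_comm_subring.

Lemma cyc_mulC : commutative (@GRing.mul cyc).
Proof.
move=> x y; apply: val_inj; rewrite !rmorphM /=.
by apply: comp_comm_mulC; exact: cyc_mxP.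
Qed.

HB.instance Definition _ := GRing.PzRing_hasCommutativeMul.Build cyc cyc_mulC.

Implicit Types x y : cyc.

Lemma cyc_inj x y : cyc_mx x = cyc_mx y -> x = y.
Proof. exact: val_inj. Qed.
Lemma cycM x y : cyc_mx (x * y) = cyc_mx x * cyc_mx y.
Proof. exact: (rmorphM (val : cyc -> 'M[R]_n.+1)). Qed.
Lemma cycD x y : cyc_mx (x + y) = cyc_mx x + cyc_mx y.
Proof. exact: (rmorphD (val : cyc -> 'M[R]_n.+1)). Qed.
Lemma cycB x y : cyc_mx (x - y) = cyc_mx x - cyc_mx y.
Proof. exact: (rmorphB (val : cyc -> 'M[R]_n.+1)). Qed.
Lemma cyc1 : cyc_mx 1 = 1.
Proof. exact: (rmorph1 (val : cyc -> 'M[R]_n.+1)). Qed.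
Lemma cycX x k : cyc_mx (x ^+ k) = cyc_mx x ^+ k.
Proof. exact: (rmorphXn (val : cyc -> 'M[R]_n.+1)). Qed.
Lemma cyc_sumE I (r : seq I) (P : pred I) (F : I -> cyc) :
  cyc_mx (\sum_(i <- r | P i) F i) = \sum_(i <- r | P i) cyc_mx (F i).
Proof. exact: (rmorph_sum (val : cyc -> 'M[R]_n.+1)). Qed.

Definition cco x (i : 'I_n.+1) : R := cyc_mx x 0 i.

Lemma cyc_ext x y : (forall i, cco x i = cco y i) -> x = y.
Proof. by move=> xy; apply/cyc_inj/comp_comm_row0 => //; exact: cyc_mxP. Qed.

Definition cscal (r : R) : cyc := Cyc (comp_comm_scalar r).
Definition zt : cyc := Cyc comp_comm_comp.

Lemma cscal_zmod : zmod_morphism cscal.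
Proof. by move=> r s; apply: cyc_inj; rewrite cycB /= raddfB. Qed.
Lemma cscal_monoid : monoid_morphism cscal.
Proof.
by split=> [|r s]; apply: cyc_inj => //; rewrite cycM /= -mulmxE -scalar_mxM.
Qed.
HB.instance Definition _ := GRing.isZmodMorphism.Build R cyc cscal cscal_zmod.
HB.instance Definition _ := GRing.isMonoidMorphism.Build R cyc cscal cscal_monoid.

Lemma cco_poly (v : 'I_n.+1 -> R) j : cco (\sum_i cscal (v i) * zt ^+ i) j = v j.
Proof.
rewrite /cco cyc_sumE -[RHS]comp_poly_row0; congr (fun_of_matrix _ 0 j).
by apply: eq_bigr => i _; rewrite cycM cycX.
Qed.

Lemma cco_scalM r x j : cco (cscal r * x) j = r * cco x j.
Proof. by rewrite /cco cycM scalar_mulmxE. Qed.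

Lemma cco_sum I (r : seq I) (P : pred I) (F : I -> cyc) j :
  cco (\sum_(i <- r | P i) F i) j = \sum_(i <- r | P i) cco (F i) j.
Proof. by rewrite /cco cyc_sumE summxE. Qed.

Lemma zt_sum : \sum_(k < n.+2) zt ^+ k = 0.
Proof.
apply: cyc_inj; rewrite cyc_sumE; under eq_bigr do rewrite cycX.
exact: comp_mx_sum.
Qed.

Definition nm x : R := \det (cyc_mx x).

Lemma nm1 : nm 1 = 1. Proof. by rewrite /nm cyc1 det1. Qed.
Lemma nmM x y : nm (x * y) = nm x * nm y.
Proof. by rewrite /nm cycM det_mulmx. Qed.
Lemma nm_scal r : nm (cscal r) = r ^+ n.+1.
Proof. by rewrite /nm det_scalar. Qed.

(** The adjugate divided by the determinant is a two-sided inverse, and the inverse of an element of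
    a centralizer lies in that centralizer. *)
Lemma nm_unit x : invertible (nm x) -> invertible x.
Proof.
case=> w xw; pose y : 'M[R]_n.+1 := w *: \adj (cyc_mx x).
have xy : cyc_mx x * y = 1.
  by rewrite -mulmxE -scalemxAr mul_mx_adj scale_scalar_mx mulrC xw.
have yx : y * cyc_mx x = 1.
  by rewrite -mulmxE -scalemxAl mul_adj_mx scale_scalar_mx mulrC xw.
have cy : comp_comm y.
  apply/comp_commP; have /comp_commP cx := cyc_mxP x; rewrite /GRing.comm.
  rewrite -[RHS]mul1r -yx -!mulrA [cyc_mx x * _]mulrA cx.
  by rewrite -[_ * _ * y]mulrA xy mulr1.
by exists (Cyc cy); apply: cyc_inj; rewrite cycM cyc1 xy.
Qed.

End Companion.

Arguments zt {n R}.
Arguments cscal {n R}.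

Section CycMap.
Variables (n : nat) (R R' : comPzRingType) (h : {rmorphism R -> R'}).

Lemma map_comp_mx : map_mx h (comp_mx n R) = comp_mx n R'.
Proof.
apply/matrixP => i j; rewrite !mxE; case: ifP => _; first by rewrite rmorph_nat.
by rewrite rmorphN1.
Qed.

Lemma map_mx_mulr (x y : 'M[R]_n.+1) : map_mx h (x * y) = map_mx h x * map_mx h y.
Proof. by rewrite -!mulmxE map_mxM. Qed.

Lemma cyc_map_subproof (x : cyc n R) : comp_comm (map_mx h x).
Proof.
have /comp_commP cx := cyc_mxP x.
by apply/comp_commP; rewrite /GRing.comm -map_comp_mx -!map_mx_mulr cx.
Qed.

Definition cyc_map_fun (x : cyc n R) : cyc n R' := Cyc (cyc_map_subproof x).

Lemma cyc_map_zmod : zmod_morphism cyc_map_fun.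
Proof.
move=> x y; apply: cyc_inj; rewrite cycB.
change (map_mx h (cyc_mx (x - y)) = map_mx h x - map_mx h y).
by rewrite cycB; apply/matrixP => i j; rewrite !mxE rmorphB.
Qed.
Lemma cyc_map_monoid : monoid_morphism cyc_map_fun.
Proof.
split=> [|x y]; apply: cyc_inj; last first.
  rewrite cycM; change (map_mx h (cyc_mx (x * y)) = map_mx h x * map_mx h y).
  by rewrite cycM map_mx_mulr.
rewrite cyc1; change (map_mx h (cyc_mx (1 : cyc n R)) = 1).
by rewrite cyc1; apply/matrixP => i j; rewrite !mxE rmorph_nat.
Qed.

Fact cyc_map_rmorphism_subproof :
  {F : {rmorphism cyc n R -> cyc n R'} | forall x, cyc_mx (F x) = map_mx h x}.
Proof.
pose F : {rmorphism cyc n R -> cyc n R'} := HB.pack cyc_map_fun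
  (GRing.isZmodMorphism.Build _ _ cyc_map_fun cyc_map_zmod)
  (GRing.isMonoidMorphism.Build _ _ cyc_map_fun cyc_map_monoid).
by exists F.
Qed.

Definition cyc_map := sval cyc_map_rmorphism_subproof.

Lemma cyc_mapE x : cyc_mx (cyc_map x) = map_mx h x.
Proof. exact: (svalP cyc_map_rmorphism_subproof). Qed.

Lemma cyc_map_co x i : cco (cyc_map x) i = h (cco x i).
Proof. by rewrite /cco cyc_mapE mxE. Qed.

Lemma cyc_map_scal r : cyc_map (cscal r) = cscal (h r).
Proof.
by apply: cyc_inj; rewrite cyc_mapE; apply/matrixP => i j; rewrite !mxE rmorphMn.
Qed.

Lemma cyc_map_zt : cyc_map zt = zt.
Proof. by apply: cyc_inj; rewrite cyc_mapE; exact: map_comp_mx. Qed.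

Lemma nm_map x : nm (cyc_map x) = h (nm x).
Proof. by rewrite /nm cyc_mapE det_map_mx. Qed.

Lemma cyc_map_surj : (forall y, exists x, h x = y) ->
  forall y, exists x, cyc_map x = y.
Proof.
move=> hs y; have /boolp.choice[v hv] i := hs (cco y i).
exists (\sum_i cscal (v i) * zt ^+ i); apply: cyc_ext => i.
by rewrite cyc_map_co cco_poly hv.
Qed.

End CycMap.

(** * Cocycles and twisted forms *)

HB.instance Definition _ (V W : finZmodType) := GRing.Zmodule.on (V * W)%type.

Section AdditiveMaps.
Variable V : zmodType.

(** On group algebras these homomorphisms induce the Hopf operations: [pr_l] and [pr_r] give w (x) 1
    and 1 (x) w, [pr_d] the comultiplication Delta, [pr_d1] and [pr_d2] Delta (x) id and id (x)
    Delta, [pr_snd] counit (x) id, [pr_0] the counit, and [pr_sub] multiplication after id (x)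
    antipode. *)
Definition pr_l (v : V) : V * V := (v, 0).
Definition pr_r (v : V) : V * V := (0, v).
Definition pr_d (v : V) : V * V := (v, v).
Definition pr_sub (u : V * V) : V := u.1 - u.2.
Definition pr_swap (u : V * V) : V * V := (u.2, u.1).
Definition pr_snd (u : V * V) : V := u.2.
Definition pr_12 (u : V * V) : V * V * V := (u.1, u.2, 0).
Definition pr_23 (u : V * V) : V * V * V := (0, u.1, u.2).
Definition pr_d1 (u : V * V) : V * V * V := (u.1, u.1, u.2).
Definition pr_d2 (u : V * V) : V * V * V := (u.1, u.2, u.2).
Definition pr_0 (v : V) : V := 0.

Lemma pr_l_zmod : zmod_morphism pr_l.
Proof. by move=> u v; rewrite /pr_l -[0 in LHS](subr0 0). Qed.
Lemma pr_r_zmod : zmod_morphism pr_r.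
Proof. by move=> u v; rewrite /pr_r -[0 in LHS](subr0 0). Qed.
Lemma pr_d_zmod : zmod_morphism pr_d. Proof. by []. Qed.
Lemma pr_sub_zmod : zmod_morphism pr_sub.
Proof.
move=> u v; change (u.1 - v.1 - (u.2 - v.2) = u.1 - u.2 - (v.1 - v.2)).
rewrite !opprB !addrA addrAC [RHS]addrAC.
by congr (_ + _); rewrite addrAC.
Qed.
Lemma pr_swap_zmod : zmod_morphism pr_swap. Proof. by []. Qed.
Lemma pr_snd_zmod : zmod_morphism pr_snd. Proof. by []. Qed.
Lemma pr_12_zmod : zmod_morphism pr_12.
Proof. by move=> u v; rewrite /pr_12 -[0 in LHS](subr0 0). Qed.
Lemma pr_23_zmod : zmod_morphism pr_23.
Proof. by move=> u v; rewrite /pr_23 -[0 in LHS](subr0 0). Qed.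
Lemma pr_d1_zmod : zmod_morphism pr_d1. Proof. by []. Qed.
Lemma pr_d2_zmod : zmod_morphism pr_d2. Proof. by []. Qed.
Lemma pr_0_zmod : zmod_morphism pr_0.
Proof. by move=> u v; rewrite /pr_0 subrr. Qed.

HB.instance Definition _ := GRing.isZmodMorphism.Build _ _ pr_l pr_l_zmod.
HB.instance Definition _ := GRing.isZmodMorphism.Build _ _ pr_r pr_r_zmod.
HB.instance Definition _ := GRing.isZmodMorphism.Build _ _ pr_d pr_d_zmod.
HB.instance Definition _ := GRing.isZmodMorphism.Build _ _ pr_sub pr_sub_zmod.
HB.instance Definition _ := GRing.isZmodMorphism.Build _ _ pr_swap pr_swap_zmod.
HB.instance Definition _ := GRing.isZmodMorphism.Build _ _ pr_snd pr_snd_zmod.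
HB.instance Definition _ := GRing.isZmodMorphism.Build _ _ pr_12 pr_12_zmod.
HB.instance Definition _ := GRing.isZmodMorphism.Build _ _ pr_23 pr_23_zmod.
HB.instance Definition _ := GRing.isZmodMorphism.Build _ _ pr_d1 pr_d1_zmod.
HB.instance Definition _ := GRing.isZmodMorphism.Build _ _ pr_d2 pr_d2_zmod.
HB.instance Definition _ := GRing.isZmodMorphism.Build _ _ pr_0 pr_0_zmod.
End AdditiveMaps.

Notation ga_push R phi := (ga_map (idfun : {rmorphism R -> R}) phi).

Lemma pairB (V W : zmodType) (a c : V) (b d : W) : (a, b) - (c, d) = (a - c, b - d).
Proof. by []. Qed.

Section Coefficients.
Variables (R : comPzRingType) (V : finZmodType).
Implicit Types (f w : grpalg R V) (C D : grpalg R (V * V)%type).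

Lemma ga_mul_lr f w g h :
  (ga_push R (@pr_l V) f * ga_push R (@pr_r V) w) (g, h) = f g * w h.
Proof.
rewrite gaM (bigD1 (g, 0)) //= big1 => [|[a b] ab].
  rewrite addr0 !ga_mapE (big_pred1 g) => [|v]; last by rewrite /= xpair_eqE eqxx andbT.
  by rewrite (big_pred1 h) // => v /=; rewrite pairB subrr subr0 xpair_eqE eqxx.
case: (eqVneq b 0) ab => [-> ag|b0 _]; last first.
  rewrite ga_mapE big_pred0 ?mul0r // => v /=; rewrite xpair_eqE.
  by rewrite eq_sym [0 == b]eq_sym (negPf b0) andbF.
rewrite [X in _ * X]ga_mapE big_pred0 ?mulr0 // => v /=.
rewrite pairB subr0 xpair_eqE; apply/negbTE; rewrite negb_and eq_sym subr_eq0.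
by move: ag; rewrite xpair_eqE eqxx andbT eq_sym => ->.
Qed.

Lemma ga_mul_d C f g h :
  (C * ga_push R (@pr_d V) f) (g, h) = \sum_k C (g - k, h - k) * f k.
Proof.
rewrite mulrC gaM.
under eq_bigr => u _ do rewrite ga_mapE mulr_suml.
rewrite (exchange_big_dep predT) //=; apply: eq_bigr => k _.
by rewrite (big_pred1 (k, k)) => [|u]; rewrite 1?eq_sym // mulrC.
Qed.
End Coefficients.

Lemma ga_push_mulE (R : comPzRingType) (V W : finZmodType) (phi : {additive V -> W})
  (f : grpalg R V) (D : grpalg R W) x :
  (ga_push R phi f * D) x = \sum_v f v * D (x - phi v).
Proof.
rewrite gaM; under eq_bigr => u _ do rewrite ga_mapE mulr_suml.
rewrite (exchange_big_dep predT) //=; apply: eq_bigr => k _.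
by rewrite (big_pred1 (phi k)) // => u; rewrite eq_sym.
Qed.

Section CocycleCoefs.
Variables (R : comPzRingType) (V : finZmodType).
Implicit Types (C : grpalg R (V * V)%type).

Lemma ga_swapE C i j : ga_push R (@pr_swap V) C (i, j) = C (j, i).
Proof.
rewrite ga_mapE (big_pred1 (j, i)) // => -[a b] /=.
by rewrite !xpair_eqE andbC.
Qed.

Lemma ga_sndE C j : ga_push R (@pr_snd V) C j = \sum_i C (i, j).
Proof.
rewrite ga_mapE.
transitivity (\sum_i \sum_(k | k == j) C (i, k)).
  by rewrite pair_big_dep /=; apply: eq_big => [|[]].
by apply: eq_bigr => i _; rewrite big_pred1_eq.
Qed.

Lemma ga_12E C a b c :
  ga_push R (@pr_12 V) C (a, b, c) = if c == 0 then C (a, b) else 0.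
Proof.
rewrite ga_mapE; case: eqP => [->|c0]; last first.
  by rewrite big_pred0 // => u; apply/negbTE/eqP => -[_ _ /esym].
by rewrite (big_pred1 (a, b)) // => -[x y] /=; rewrite !xpair_eqE eqxx andbT.
Qed.

Lemma ga_23E C a b c :
  ga_push R (@pr_23 V) C (a, b, c) = if a == 0 then C (b, c) else 0.
Proof.
rewrite ga_mapE; case: eqP => [->|c0]; last first.
  by rewrite big_pred0 // => u; apply/negbTE/eqP => -[/esym].
by rewrite (big_pred1 (b, c)) // => -[x y] /=; rewrite !xpair_eqE eqxx.
Qed.

Lemma ga_12_d1E C g h l :
  (ga_push R (@pr_12 V) C * ga_push R (@pr_d1 V) C) (g, h, l) =
  \sum_k C (g - k, h - k) * C (k, l).
Proof.
rewrite mulrC ga_push_mulE.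
transitivity (\sum_k \sum_m C (k, m) * ga_push R (@pr_12 V) C ((g, h, l) - pr_d1 (k, m))).
  by rewrite pair_bigA; apply: eq_bigr => -[].
apply: eq_bigr => k _; rewrite (bigD1 l) //= big1 => [|m ml].
  by rewrite addr0 !pairB ga_12E subrr eqxx mulrC.
by rewrite !pairB ga_12E subr_eq0 eq_sym (negPf ml) mulr0.
Qed.

Lemma ga_23_d2E C g h l :
  (ga_push R (@pr_23 V) C * ga_push R (@pr_d2 V) C) (g, h, l) =
  \sum_k C (h - k, l - k) * C (g, k).
Proof.
rewrite mulrC ga_push_mulE.
transitivity (\sum_m \sum_k C (m, k) * ga_push R (@pr_23 V) C ((g, h, l) - pr_d2 (m, k))).
  by rewrite pair_bigA; apply: eq_bigr => -[].
rewrite exchange_big /=; apply: eq_bigr => k _; rewrite (bigD1 g) //= big1 => [|m mg].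
  by rewrite addr0 !pairB ga_23E subrr eqxx mulrC.
by rewrite !pairB ga_23E subr_eq0 eq_sym (negPf mg) mulr0.
Qed.

Lemma ga_assoc_coef C g h l :
  ga_push R (@pr_12 V) C * ga_push R (@pr_d1 V) C =
    ga_push R (@pr_23 V) C * ga_push R (@pr_d2 V) C ->
  \sum_k C (g - k, h - k) * C (k, l) = \sum_k C (h - k, l - k) * C (g, k).
Proof. by move=> e; rewrite -ga_12_d1E e ga_23_d2E. Qed.

(** Each field feeds one property of the twisted product: [cc_sym] commutativity, [cc_counit] the
    unit, [cc_assoc] (the 2-cocycle identity) associativity, and [cc_unit] the Galois property. *)
Record cocycle := Cocycle {
  cc :> grpalg R (V * V)%type;
  cc_sym : ga_push R (@pr_swap V) cc = cc;
  cc_counit : ga_push R (@pr_snd V) cc = 1;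
  cc_assoc : ga_push R (@pr_12 V) cc * ga_push R (@pr_d1 V) cc =
             ga_push R (@pr_23 V) cc * ga_push R (@pr_d2 V) cc;
  cc_unit : invertible cc
}.

(* For [w] invertible: [C] is the coboundary (w (x) 1) (1 (x) w) Delta(w)^-1. *)
Definition splits (C : grpalg R (V * V)%type) (w : grpalg R V) :=
  ga_push R (@pr_l V) w * ga_push R (@pr_r V) w = C * ga_push R (@pr_d V) w
  /\ \sum_v w v = 1.

Lemma splitsM (C : grpalg R (V * V)%type) (w : grpalg R V) : splits C w ->
  forall g h, w g * w h = \sum_k C (g - k, h - k) * w k.
Proof. by case=> sw _ g h; rewrite -ga_mul_lr sw ga_mul_d. Qed.

Lemma ga_push0 (w : grpalg R V) :
  ga_push R (@pr_0 V) w = ga_scal (\sum_v w v).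
Proof.
rewrite ga_liftE rmorph_sum; apply: eq_bigr => v _ /=.
by rewrite /pr_0 ga_mono0 mulr1.
Qed.

Lemma ga_push_comp (U W : finZmodType) (phi : {additive V -> U})
  (psi : {additive U -> W}) (chi : {additive V -> W}) (f : grpalg R V) :
  (forall v, psi (phi v) = chi v) ->
  ga_push R psi (ga_push R phi f) = ga_push R chi f.
Proof.
move=> pc; apply: (@ga_ext _ _ _ (ga_push R psi \o ga_push R phi) (ga_push R chi)).
  by move=> r /=; rewrite !ga_map_scal.
by move=> v /=; rewrite !ga_map_mono pc.
Qed.

Lemma invertible_divl (X : comPzRingType) (a b : X) : invertible (a * b) -> invertible a.
Proof. by case=> c abc; exists (b * c); rewrite mulrA. Qed.

Lemma invertible_morph (X Y : comPzRingType) (f : {rmorphism X -> Y}) a :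
  invertible a -> invertible (f a).
Proof. by case=> c ac; exists (f c); rewrite -rmorphM ac rmorph1. Qed.

(** Under [pr_sub] the left side becomes w times its antipode, while Delta(w) collapses to the
    counit of w, which is 1. So w divides the image of C, a unit. *)
Lemma splits_unit (C : grpalg R (V * V)%type) (w : grpalg R V) :
  invertible C -> splits C w -> invertible w.
Proof.
move=> uC [sw w1]; pose m := ga_push R (@pr_sub V).
have mC : invertible (m C) by exact: invertible_morph.
have : m (ga_push R (@pr_l V) w) * m (ga_push R (@pr_r V) w) = m C.
  rewrite -rmorphM sw rmorphM (@ga_push_comp _ _ _ _ (@pr_0 V)); last first.
    by move=> v; exact: subrr.
  by rewrite ga_push0 w1 rmorph1 mulr1.
rewrite (@ga_push_comp _ _ _ _ (idfun : {additive V -> V})); last first.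
  by move=> v; exact: subr0.
have -> : ga_push R (idfun : {additive V -> V}) w = w.
  by apply/ffunP => v; rewrite ga_coefE.
by move=> e; move: mC; rewrite -e; exact: invertible_divl.
Qed.

End CocycleCoefs.

(* The product is s_g s_h = sum_k C(g - k, h - k) s_k on the indicator functions. *)
Definition twisted_functions (R : comPzRingType) (V : finZmodType) of cocycle R V :=
  {ffun V -> R}.

(** * The twisted form attached to a cocycle, and its Galois property *)

Section Twist.
Variables (R : comPzRingType) (V : finZmodType) (C : cocycle R V).

Local Notation twist := (twisted_functions C).
HB.instance Definition _ := GRing.Zmodule.copy twist {ffun V -> R}.

Definition tw_mul (a b : twist) : twist :=
  [ffun k => \sum_g \sum_h a g * b h * cc C (g - k, h - k)].
(** The normal basis (s_g) is normalized to have sum 1, so scalars are the constant functions. *)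
Definition tw_one : twist := [ffun=> 1].
Definition tw_s (g : V) : twist := [ffun k => (k == g)%:R].
Definition tw_in (r : R) : twist := [ffun=> r].

Lemma tw_mulC : commutative tw_mul.
Proof.
move=> a b; apply/ffunP => k; rewrite !ffunE exchange_big; apply: eq_bigr => g _.
apply: eq_bigr => h _; rewrite [b _ * _]mulrC; congr (_ * _).
by rewrite -{1}(cc_sym C) ga_swapE.
Qed.

Lemma cc_assocE g h l m :
  \sum_k cc C (g - k, h - k) * cc C (k - m, l - m) =
  \sum_k cc C (h - k, l - k) * cc C (g - m, k - m).
Proof.
have e := ga_assoc_coef (g - m) (h - m) (l - m) (cc_assoc C).
rewrite (reindex_inj (addIr m)) /= [RHS](reindex_inj (addIr m)) /=.
under eq_bigr do rewrite addrK !opprD !addrA ![_ - _ - m]addrAC.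
by under [RHS]eq_bigr do rewrite addrK !opprD !addrA ![_ - _ - m]addrAC.
Qed.

Lemma tw_mulA : associative tw_mul.
Proof.
move=> a b c; apply/ffunP => m; rewrite !ffunE.
transitivity (\sum_g \sum_h \sum_l a g * b h * c l *
    (\sum_k cc C (h - k, l - k) * cc C (g - m, k - m))).
  apply: eq_bigr => g _.
  transitivity (\sum_k \sum_h \sum_l
      a g * b h * c l * (cc C (h - k, l - k) * cc C (g - m, k - m))).
    apply: eq_bigr => k _; rewrite ffunE mulr_sumr mulr_suml; apply: eq_bigr => h _.
    by rewrite mulr_sumr mulr_suml; apply: eq_bigr => l _; ring.
  rewrite exchange_big; apply: eq_bigr => h _; rewrite exchange_big.
  by apply: eq_bigr => l _; rewrite mulr_sumr.
transitivity (\sum_k \sum_l \sum_g \sum_h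
    a g * b h * c l * (cc C (g - k, h - k) * cc C (k - m, l - m))).
  rewrite [RHS]exchange_big /=.
  under eq_bigr do rewrite exchange_big /=.
  rewrite exchange_big; apply: eq_bigr => l _ /=.
  rewrite [RHS]exchange_big; apply: eq_bigr => g _ /=.
  rewrite [RHS]exchange_big; apply: eq_bigr => h _ /=.
  by rewrite -cc_assocE mulr_sumr.
apply: eq_bigr => k _; apply: eq_bigr => l _; rewrite ffunE !mulr_suml.
by apply: eq_bigr => g _; rewrite !mulr_suml; apply: eq_bigr => h _; ring.
Qed.

Lemma tw_mul1 : left_id tw_one tw_mul.
Proof.
move=> a; apply/ffunP => k; rewrite ffunE exchange_big /=.
transitivity (\sum_h a h * (h - k == 0)%:R).
  apply: eq_bigr => h _; rewrite -ga1 -(cc_counit C) ga_sndE mulr_sumr.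
  rewrite [RHS](reindex_inj (addIr (- k))) /=.
  by apply: eq_bigr => g _; rewrite ffunE mul1r.
rewrite (bigD1 k) //= subrr eqxx mulr1 big1 ?addr0 // => h hk.
by rewrite subr_eq0 (negPf hk) mulr0.
Qed.

Lemma tw_mulDl : left_distributive tw_mul +%R.
Proof.
move=> a b c; apply/ffunP => k; rewrite !ffunE -big_split; apply: eq_bigr => g _.
rewrite -big_split; apply: eq_bigr => h _ /=.
by rewrite ffunE !mulrDl.
Qed.

HB.instance Definition _ := GRing.Zmodule_isComPzRing.Build twist
  tw_mulA tw_mulC tw_mul1 tw_mulDl.

Lemma twM (a b : twist) k : (a * b) k = \sum_g \sum_h a g * b h * cc C (g - k, h - k).
Proof. by rewrite [LHS]ffunE. Qed.

Lemma tw_inM r (a : twist) k : (tw_in r * a) k = r * a k.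
Proof.
transitivity (r * ((1 : twist) * a) k); last by rewrite mul1r.
rewrite !twM mulr_sumr; apply: eq_bigr => g _; rewrite mulr_sumr.
by apply: eq_bigr => h _; rewrite !ffunE mul1r !mulrA.
Qed.

Lemma tw_in_zmod : zmod_morphism tw_in.
Proof. by move=> r s; apply/ffunP => k; rewrite !ffunE. Qed.
Lemma tw_in_monoid : monoid_morphism tw_in.
Proof. by split=> [|r s]; apply/ffunP => k; rewrite ?tw_inM !ffunE. Qed.
HB.instance Definition _ := GRing.isZmodMorphism.Build R twist tw_in tw_in_zmod.
HB.instance Definition _ := GRing.isMonoidMorphism.Build R twist tw_in tw_in_monoid.

Lemma tw_decomp (a : twist) : a = \sum_v tw_in (a v) * tw_s v.
Proof.
apply/ffunP => k; rewrite sum_ffunE (bigD1 k) //= tw_inM ffunE eqxx mulr1.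
rewrite big1 ?addr0 // => v vk.
by rewrite tw_inM ffunE eq_sym (negPf vk) mulr0.
Qed.

Lemma tw_sM g h : tw_s g * tw_s h = \sum_k tw_in (cc C (g - k, h - k)) * tw_s k.
Proof.
rewrite [LHS]tw_decomp; apply: eq_bigr => k _; congr (tw_in _ * _).
rewrite twM (bigD1 g) //= (bigD1 h) //= !ffunE !eqxx !mul1r.
rewrite !big1 ?addr0 // => [i ig|i ih].
  by rewrite big1 // => j _; rewrite !ffunE (negPf ig) !mul0r.
by rewrite !ffunE (negPf ih) mulr0 mul0r.
Qed.

Definition tw_w : grpalg twist V := [ffun g => tw_s g].

Lemma tw_w_splits : splits (ga_coef (V * V)%type tw_in (cc C)) tw_w.
Proof.
split.
  apply/ffunP => -[g h]; rewrite ga_mul_lr ga_mul_d !ffunE tw_sM.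
  by apply: eq_bigr => k _; rewrite ga_coefE ffunE.
under eq_bigr do rewrite ffunE.
rewrite [RHS]tw_decomp; apply: eq_bigr => v _.
by rewrite [in RHS]ffunE rmorph1 mul1r.
Qed.

Definition tw_shift (i : V) (a : twist) : twist := [ffun k => a (k + i)].

Lemma tw_shift_zmod i : zmod_morphism (tw_shift i).
Proof. by move=> a b; apply/ffunP => k; rewrite !ffunE. Qed.
Lemma tw_shift_monoid i : monoid_morphism (tw_shift i).
Proof.
split=> [|a b]; apply/ffunP => k; first by rewrite !ffunE.
rewrite ffunE !twM (reindex_inj (addIr i)); apply: eq_bigr => g _ /=.
rewrite (reindex_inj (addIr i)); apply: eq_bigr => h _ /=.
by rewrite !ffunE !(addrC k) !opprD !addrA !addrK.
Qed.
HB.instance Definition _ i :=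
  GRing.isZmodMorphism.Build twist twist (tw_shift i) (tw_shift_zmod i).
HB.instance Definition _ i :=
  GRing.isMonoidMorphism.Build twist twist (tw_shift i) (tw_shift_monoid i).

Variables (G : finGroupType) (io : G -> V).
Hypothesis ioM : forall x y, io (x * y)%g = io x + io y.
Hypothesis io_inj : injective io.
Hypothesis io_surj : forall v, exists x, io x = v.

Let act (x : G) : {rmorphism twist -> twist} := tw_shift (io x).

Lemma io1 : io 1%g = 0.
Proof. by apply: (addrI (io 1%g)); rewrite -ioM mulg1 addr0. Qed.

Lemma tw_act1 a : act 1%g a = a.
Proof. by apply/ffunP => k; rewrite !ffunE io1 addr0. Qed.
Lemma tw_actM x y a : act (x * y)%g a = act x (act y a).
Proof. by apply/ffunP => k; rewrite !ffunE ioM addrA. Qed.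
Lemma tw_act_in x r : act x (tw_in r) = tw_in r.
Proof. by apply/ffunP => k; rewrite !ffunE. Qed.

Definition twist_galg : galgebra G R :=
  @GAlgebra G R twist tw_in act tw_act1 tw_actM tw_act_in.

Lemma tw_act_s x v : act x (tw_s v) = tw_s (v - io x).
Proof. by apply/ffunP => k; rewrite !ffunE [in RHS]eq_sym subr_eq eq_sym. Qed.

(** Invariance under all shifts means being constant. For the second condition let t be the inverse
    of w = sum_v s_v [v]. Since a in G multiplies w by [io a], the product of w and a(t) is
    [- io a], whose coefficient at 0 is the Kronecker delta; hence the pairs s_v, t(-v). *)
Lemma twist_galois : galois twist_galg.
Proof.
split=> [r s /ffunP/(_ 0)|a|]; first by rewrite !ffunE.
  split=> [inva|[r <-] x]; last exact: tw_act_in.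
  exists (a 0); apply/ffunP => k; have [x xk] := io_surj k.
  by move/ffunP: (inva x) => /(_ 0); rewrite !ffunE add0r xk.
have uC : invertible (ga_coef (V * V)%type tw_in (cc C)).
  by apply: invertible_morph; exact: cc_unit.
have [t wt] := splits_unit uC tw_w_splits.
have [n [x [y xy]]] : exists n (x y : 'I_n -> twist),
   forall a : G, \sum_i x i * act a (y i) = \sum_v tw_s v * act a (t (- v)).
  exists #|V|, (fun i => tw_s (enum_val i)), (fun i => t (- enum_val i)) => a.
  by rewrite [RHS](big_enum_val) /=.
exists n, x, y => a; rewrite xy.
have /(congr1 (ga_coef V (act a))) := wt; rewrite rmorph1 rmorphM.
have -> : ga_coef V (act a) tw_w = ga_mono (io a) * tw_w.
  by apply/ffunP => v; rewrite ga_coefE ga_monoM !ffunE tw_act_s.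
move=> /(congr1 (fun f => ga_mono (- io a) * f)).
rewrite !mulrA -ga_monoD addNr ga_mono0 mul1r mulr1.
move/ffunP/(_ 0); rewrite gaM ffunE eq_sym oppr_eq0 -io1 (inj_eq io_inj) => <-.
by apply: eq_bigr => v _; rewrite io1 sub0r ga_coefE ffunE.
Qed.
End Twist.

(** * Recognizing a Galois algebra with an equivariant splitting as a base-changed twisted form *)

Section Comparison.
Variables (R1 R2 : comPzRingType) (g : {rmorphism R1 -> R2}).
Variables (V : finZmodType) (C : cocycle R1 V).
Variables (G : finGroupType) (io : G -> V).
Hypothesis ioM : forall x y, io (x * y)%g = io x + io y.
Hypothesis io_inj : injective io.
Hypothesis io_surj : forall v, exists x, io x = v.
Variables (S : galgebra G R2) (om : grpalg S V).
Hypothesis galS : galois S.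
Variable j : {rmorphism R1 -> S}.
Hypothesis jE : forall r, j r = galg_in S (g r).
Hypothesis om_split : splits (ga_coef (V * V)%type j (cc C)) om.
Hypothesis om_act : forall x v, galg_act S x (om v) = om (v - io x).

Let T := twist_galg C ioM.

Definition cmp_fun (a : twisted_functions C) : S := \sum_v j (a v) * om v.

Lemma cmp_zmod : zmod_morphism cmp_fun.
Proof.
move=> a b; rewrite /cmp_fun -sumrB; apply: eq_bigr => v _.
by rewrite !ffunE rmorphB mulrBl.
Qed.

Lemma cmp_monoid : monoid_morphism cmp_fun.
Proof.
split=> [|a b]; rewrite /cmp_fun.
  case: om_split => _ <-; apply: eq_bigr => v _.
  by rewrite ffunE rmorph1 mul1r.
rewrite mulr_suml.
transitivity (\sum_g \sum_h \sum_k j (a g * b h) * (j (cc C (g - k, h - k)) * om k)).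
  under eq_bigr => k _ do rewrite twM rmorph_sum mulr_suml.
  rewrite exchange_big; apply: eq_bigr => u _ /=.
  under eq_bigr => k _ do rewrite rmorph_sum mulr_suml.
  rewrite exchange_big; apply: eq_bigr => h _ /=.
  by apply: eq_bigr => k _; rewrite rmorphM mulrA.
apply: eq_bigr => u _; rewrite mulr_sumr; apply: eq_bigr => h _.
rewrite -mulr_sumr mulrACA -rmorphM (splitsM om_split); congr (_ * _).
by apply: eq_bigr => k _; rewrite ga_coefE.
Qed.

HB.instance Definition _ :=
  GRing.isZmodMorphism.Build (twisted_functions C) S cmp_fun cmp_zmod.
HB.instance Definition _ :=
  GRing.isMonoidMorphism.Build (twisted_functions C) S cmp_fun cmp_monoid.

Lemma cmp_in r : cmp_fun (tw_in C r) = j r.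
Proof.
case: om_split => _ om1; rewrite -[RHS]mulr1 -om1 mulr_sumr.
by apply: eq_bigr => v _; rewrite ffunE.
Qed.

Lemma cmp_s v : cmp_fun (tw_s C v) = om v.
Proof.
rewrite /cmp_fun (bigD1 v) //= ffunE eqxx rmorph1 mul1r big1 ?addr0 // => u uv.
by rewrite ffunE (negPf uv) rmorph0 mul0r.
Qed.

Lemma cmp_act x a : cmp_fun (galg_act T x a) = galg_act S x (cmp_fun a).
Proof.
rewrite /cmp_fun rmorph_sum (reindex_inj (addIr (- io x))) /=; apply: eq_bigr => v _.
by rewrite ffunE subrK rmorphM om_act jE galg_act_in.
Qed.

Lemma om_unit : invertible om.
Proof.
apply: splits_unit om_split; apply: invertible_morph; exact: cc_unit.
Qed.

(** The conjugates of the relation under G are precisely the coefficients of the product [rb * om]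
    in S[V], and [om] is invertible there. *)
Lemma om_free (r : V -> R2) : \sum_v galg_in S (r v) * om v = 0 -> forall v, r v = 0.
Proof.
move=> r0 v; case: galS => in_inj _ _; apply: in_inj; rewrite rmorph0.
pose rb : grpalg S V := [ffun u => galg_in S (r (- u))].
suff rbom : rb * om = 0.
  have [t omt] := om_unit.
  have : rb = 0 by rewrite -[rb]mulr1 -omt mulrA rbom mul0r.
  by move/ffunP/(_ (- v)); rewrite !ffunE opprK.
apply/ffunP => u; have [x xu] := io_surj (- u).
rewrite gaM ffunE -[RHS](rmorph0 (galg_act S x)) -[in RHS]r0 rmorph_sum.
rewrite (reindex_inj (@oppr_inj V)); apply: eq_bigr => k _.
by rewrite ffunE opprK rmorphM galg_act_in om_act xu opprK addrC.
Qed.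

(** The orbit of s, collected in [st], transforms under G by the same factor as [om]. The quotient
    [rb] is therefore invariant and has coefficients in R2; the coefficient at 0 of [rb * om = st]
    is s. *)
Lemma om_span s : exists r : V -> R2, s = \sum_v galg_in S (r v) * om v.
Proof.
have [t omt] := om_unit.
have /boolp.choice[el elE] := io_surj.
pose st : grpalg S V := [ffun x => galg_act S (el (- x)) s].
pose rb := st * t.
have rbom : rb * om = st by rewrite -mulrA [t * _]mulrC omt mulr1.
have coefM x (f h : grpalg S V) :
  ga_coef V (galg_act S x) (f * h) = ga_coef V (galg_act S x) f * ga_coef V (galg_act S x) h.
  exact: rmorphM.
have omx x : ga_coef V (galg_act S x) om = ga_mono (io x) * om.
  by apply/ffunP => v; rewrite ga_coefE om_act ga_monoM.
have stx x : ga_coef V (galg_act S x) st = ga_mono (io x) * st.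
  apply/ffunP => v; rewrite ga_coefE ga_monoM !ffunE -galg_actM.
  by congr (galg_act S _ s); apply: io_inj; rewrite ioM !elE opprB.
have tx x : ga_coef V (galg_act S x) t = ga_mono (- io x) * t.
  have e : ga_coef V (galg_act S x) t * (ga_mono (io x) * om) = 1.
    by rewrite -omx mulrC -coefM omt rmorph1.
  rewrite -[LHS]mulr1 -omt mulrA -[ga_coef _ _ _ * om]mul1r -(ga_mono0 S) -(addNr (io x)).
  rewrite ga_monoD -!mulrA [X in _ * X]mulrCA [ga_mono _ * (om * t)]mulrA.
  by rewrite [X in _ * X]mulrA e mul1r.
have rbx x v : galg_act S x (rb v) = rb v.
  rewrite -ga_coefE coefM stx tx mulrACA -ga_monoD subrr ga_mono0 mul1r; by [].
case: galS => _ inv _.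
have /boolp.choice[r rE] : forall v, exists r, galg_in S r = rb (- v).
  by move=> v; apply/inv => x; exact: rbx.
exists r; transitivity (st 0).
  rewrite ffunE (_ : el _ = 1%g) ?galg_act1 //.
  by apply: io_inj; rewrite elE oppr0 (io1 ioM).
rewrite -rbom gaM (reindex_inj (@oppr_inj V)); apply: eq_bigr => v _.
by rewrite rE sub0r opprK.
Qed.

Lemma twist_base_change_iso : galgebra_iso (base_change g T) S.
Proof.
pose TT := tensor (galg_in T) g.
pose f (a : T) (b : R2) : S := cmp_fun a * galg_in S b.
have [|||u uE _] := @tensor_universal R1 T R2 (galg_in T) g S f.
- by move=> a a' b; rewrite /f (rmorphD cmp_fun) mulrDl.
- by move=> a b b'; rewrite /f rmorphD mulrDr.
- move=> r a b; rewrite /f rmorphM.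
  have -> : cmp_fun (galg_in T r * a) = j r * cmp_fun a.
    by rewrite -cmp_in -(rmorphM cmp_fun).
  by rewrite jE; ring.
have uM : monoid_morphism u.
  split; first by rewrite [LHS]uE /f !rmorph1 mulr1.
  move=> x y; have [s ->] := tensor_spanned x; have [t ->] := tensor_spanned y.
  rewrite mulr_suml !raddf_sum mulr_suml; apply: eq_bigr => -[a b] _.
  rewrite !mulr_sumr raddf_sum; apply: eq_bigr => -[a' b'] _ /=.
  by rewrite pure_tensorM !uE /f (rmorphM cmp_fun) rmorphM; ring.
pose u0 : TT -> S := u.
have uZ : zmod_morphism u0 by move=> x y; exact: raddfB.
pose F : {rmorphism TT -> S} := HB.pack u0
  (GRing.isZmodMorphism.Build _ _ u0 uZ) (GRing.isMonoidMorphism.Build _ _ u0 uM).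
have FE a b : F (pure_tensor (galg_in T) g a b) = f a b by exact: uE.
(* Every tensor can be written on the basis s_v (x) 1, which reduces bijectivity of F to [om] being
   a basis of S over R2. *)
have span (x : TT) : exists r, x = \sum_v pure_tensor (galg_in T) g (tw_s C v) (r v).
  have [s ->] := tensor_spanned x; exists (fun v => \sum_(y <- s) g (y.1 v) * y.2).
  have dr v : pure_tensor (galg_in T) g (tw_s C v) (\sum_(y <- s) g (y.1 v) * y.2) =
      \sum_(y <- s) pure_tensor (galg_in T) g (tw_s C v) (g (y.1 v) * y.2).
    elim: s => [|y s IHs]; first by rewrite !big_nil pure_tensor0r.
    by rewrite !big_cons pure_tensorDr IHs.
  under [RHS]eq_bigr do rewrite dr.
  rewrite exchange_big; apply: eq_bigr => -[a b] _ /=.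
  under [RHS]eq_bigr do rewrite -pure_tensor_balanced.
  have -> : pure_tensor (galg_in T) g a b =
     pure_tensor (galg_in T) g (\sum_v tw_in C (a v) * tw_s C v) b.
    by rewrite -tw_decomp.
  apply: (big_morph (fun z => pure_tensor (galg_in T) g z b)).
    by move=> z z'; rewrite pure_tensorDl.
  exact: pure_tensor0l.
have FsE r : F (\sum_v pure_tensor (galg_in T) g (tw_s C v) (r v)) =
    \sum_v galg_in S (r v) * om v.
  by rewrite rmorph_sum; apply: eq_bigr => v _; rewrite FE /f cmp_s mulrC.
have Finj : injective F.
  move=> x y xy; apply/eqP; rewrite -subr_eq0; apply/eqP.
  have [r xyE] := span (x - y).
  have : F (x - y) = 0 by rewrite rmorphB xy subrr.
  rewrite xyE FsE => /om_free r0; apply: big1 => v _.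
  by rewrite r0 pure_tensor0r.
have Fsurj s : exists x, F x = s.
  by have [r ->] := om_span s; eexists; exact: FsE.
exists F; split.
- have /boolp.choice[k kE] := Fsurj.
  by exists k => // x; apply: Finj; rewrite kE.
- by move=> r; rewrite [LHS]FE /f rmorph1 mul1r.
- move=> x s; have [t ->] := tensor_spanned s.
  rewrite !rmorph_sum; apply: eq_bigr => -[a b] _.
  rewrite [galg_act _ _ _]tensor_mapl_pure; last exact: galg_act_in.
  by rewrite !FE /f cmp_act rmorphM galg_act_in.
Qed.

End Comparison.

(** * Norms of cocycles *)

Section GroupAlgebraNorm.
Variable n : nat.

Lemma cscal_mono_char (R : comPzRingType) (W : finZmodType) :
  expo_char (fun v : W => cscal (ga_mono v) : cyc n (grpalg R W)).
Proof. by split=> [|u v]; rewrite ?ga_mono0 ?rmorph1 ?ga_monoD ?rmorphM. Qed.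

(** The canonical map from (R (x) Z[zeta])[W] to R[W] (x) Z[zeta]; on the target the norm is a
    determinant with entries in R[W]. *)
Definition ga_cyc (R : comPzRingType) (W : finZmodType) :
    {rmorphism grpalg (cyc n R) W -> cyc n (grpalg R W)} :=
  ga_lift (cyc_map n (@ga_scal R W)) (cscal_mono_char R W).

Lemma ga_cyc_scal R W r : @ga_cyc R W (ga_scal r) = cyc_map n (@ga_scal R W) r.
Proof. exact: ga_lift_scal. Qed.
Lemma ga_cyc_mono R W v : @ga_cyc R W (ga_mono v) = cscal (ga_mono v).
Proof. exact: ga_lift_mono. Qed.

Lemma ga_cyc_nat (R R' : comPzRingType) (W W' : finZmodType)
  (h : {rmorphism R -> R'}) (phi : {additive W -> W'}) (x : grpalg (cyc n R) W) :
  ga_cyc R' W' (ga_map (cyc_map n h) phi x) = cyc_map n (ga_map h phi) (ga_cyc R W x).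
Proof.
apply: (@ga_ext _ _ _ (ga_cyc R' W' \o ga_map (cyc_map n h) phi)
  (cyc_map n (ga_map h phi) \o ga_cyc R W)) => [r|v] /=.
  rewrite ga_map_scal !ga_cyc_scal; apply: cyc_ext => i.
  by rewrite !cyc_map_co ga_map_scal.
by rewrite ga_map_mono !ga_cyc_mono cyc_map_scal ga_map_mono.
Qed.

Definition gnm (R : comPzRingType) (W : finZmodType) (x : grpalg (cyc n R) W) :
  grpalg R W := nm (ga_cyc R W x).

Section Theory.
Variables (R : comPzRingType) (W : finZmodType).
Implicit Types x y : grpalg (cyc n R) W.

Lemma gnm1 : gnm (1 : grpalg (cyc n R) W) = 1.
Proof. by rewrite /gnm rmorph1 nm1. Qed.
Lemma gnmM x y : gnm (x * y) = gnm x * gnm y.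
Proof. by rewrite /gnm rmorphM nmM. Qed.
Lemma gnm_mono v : gnm (ga_mono v : grpalg (cyc n R) W) = ga_mono v ^+ n.+1.
Proof. by rewrite /gnm ga_cyc_mono nm_scal. Qed.
Lemma gnm_invertible x : invertible x -> invertible (gnm x).
Proof. by case=> y xy; exists (gnm y); rewrite -gnmM xy gnm1. Qed.
End Theory.

Lemma gnm_map (R R' : comPzRingType) (W W' : finZmodType)
  (h : {rmorphism R -> R'}) (phi : {additive W -> W'}) (x : grpalg (cyc n R) W) :
  gnm (ga_map (cyc_map n h) phi x) = ga_map h phi (gnm x).
Proof. by rewrite /gnm ga_cyc_nat nm_map. Qed.

Lemma gnm_push (R : comPzRingType) (W W' : finZmodType)
  (phi : {additive W -> W'}) (x : grpalg (cyc n R) W) :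
  gnm (ga_push (cyc n R) phi x) = ga_push R phi (gnm x).
Proof.
rewrite -(gnm_map idfun phi x).
suff -> : ga_push (cyc n R) phi x = ga_map (cyc_map n idfun) phi x by [].
apply/ffunP => w; rewrite ga_mapE [RHS]ga_mapE; apply: eq_bigr => v _ /=.
by apply: cyc_ext => i; rewrite cyc_map_co.
Qed.

Section NormCocycle.
Variables (R : comPzRingType) (V : finZmodType) (C : cocycle (cyc n R) V).

Lemma gnm_cc_unit : exists D, gnm (cc C) * D = 1.
Proof. exact: gnm_invertible (cc_unit C). Qed.

Lemma inverse_unique (X : comPzRingType) (a b c : X) : a * b = 1 -> a * c = 1 -> b = c.
Proof. by move=> ab ac; rewrite -[b]mul1r -ac mulrAC ab mul1r. Qed.

Lemma inverseM (X : comPzRingType) (a b c d : X) :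
  a * b = 1 -> c * d = 1 -> (a * c) * (b * d) = 1.
Proof. by move=> ab cd; rewrite mulrACA ab cd mulr1. Qed.

(** All the cocycle identities are multiplicative equations between pushforwards, with which the
    norm commutes. They pass to the norm, and then to its inverse by uniqueness of inverses. *)
Lemma norm_cocycle_ex : exists D : cocycle R V, gnm (cc C) * cc D = 1.
Proof.
have [D CD] := gnm_cc_unit.
have pushD (W : finZmodType) (phi : {additive (V * V)%type -> W}) :
    gnm (ga_push (cyc n R) phi (cc C)) * ga_push R phi D = 1.
  by rewrite gnm_push -rmorphM CD rmorph1.
have sD : ga_push R (@pr_swap V) D = D.
  have e := pushD _ (@pr_swap V); rewrite cc_sym in e.
  exact: inverse_unique e CD.
have uD : ga_push R (@pr_snd V) D = 1.
  by have e := pushD _ (@pr_snd V); rewrite cc_counit gnm1 mul1r in e.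
have aD : ga_push R (@pr_12 V) D * ga_push R (@pr_d1 V) D =
    ga_push R (@pr_23 V) D * ga_push R (@pr_d2 V) D.
  have e1 := inverseM (pushD _ (@pr_12 V)) (pushD _ (@pr_d1 V)).
  have e2 := inverseM (pushD _ (@pr_23 V)) (pushD _ (@pr_d2 V)).
  rewrite -gnmM cc_assoc gnmM in e1.
  exact: inverse_unique e1 e2.
have iD : invertible D by exists (gnm (cc C)); rewrite mulrC.
by exists (Cocycle sD uD aD iD).
Qed.
End NormCocycle.

Lemma gnm_splits (R : comPzRingType) (V : finZmodType)
  (C : grpalg (cyc n R) (V * V)%type) (w : grpalg (cyc n R) V)
  (D : grpalg R (V * V)%type) (om : grpalg R V) :
  splits C w -> gnm C * D = 1 -> gnm w * om = 1 -> splits D om.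
Proof.
move=> [sw w1] CD wom.
have pushw (W : finZmodType) (phi : {additive V -> W}) :
    gnm (ga_push (cyc n R) phi w) * ga_push R phi om = 1.
  by rewrite gnm_push -rmorphM wom rmorph1.
split.
  have e1 := inverseM (pushw _ (@pr_l V)) (pushw _ (@pr_r V)).
  have e2 := inverseM CD (pushw _ (@pr_d V)).
  rewrite -gnmM sw gnmM in e1.
  exact: inverse_unique e1 e2.
have := pushw _ (@pr_0 V); rewrite !ga_push0 w1 rmorph1 gnm1 mul1r.
by move/ffunP/(_ 0); rewrite !ffunE eqxx mulr1.
Qed.

End GroupAlgebraNorm.

(** * Fourier transform *)

Section Fourier.
Variable U : comPzRingType.

Definition ft (W : finZmodType) (t : W -> U) (f : grpalg U W) : U := \sum_v f v * t v.

Section FourierTheory.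
Variables (W : finZmodType) (t : W -> U).
Hypothesis tchar : expo_char t.

Lemma ft_liftE f : ft t f = ga_lift idfun tchar f.
Proof. by rewrite ga_liftE. Qed.

Lemma ftM f g : ft t (f * g) = ft t f * ft t g.
Proof. by rewrite !ft_liftE rmorphM. Qed.
Lemma ftD f g : ft t (f + g) = ft t f + ft t g.
Proof. by rewrite !ft_liftE rmorphD. Qed.
Lemma ftB f g : ft t (f - g) = ft t f - ft t g.
Proof. by rewrite !ft_liftE rmorphB. Qed.
Lemma ft1 : ft t 1 = 1.
Proof. by rewrite !ft_liftE rmorph1. Qed.
Lemma ft0 : ft t 0 = 0.
Proof. by rewrite !ft_liftE rmorph0. Qed.
Lemma ft_scal r : ft t (ga_scal r) = r.
Proof. by rewrite ft_liftE ga_lift_scal. Qed.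
Lemma ft_mono v : ft t (ga_mono v) = t v.
Proof. by rewrite ft_liftE ga_lift_mono. Qed.

Lemma ft_push (W' : finZmodType) (phi : {additive W' -> W}) f :
  ft t (ga_push U phi f) = ft (t \o phi) f.
Proof.
rewrite ft_liftE [X in ga_lift _ _ X]ga_liftE raddf_sum; apply: eq_bigr => v _ /=.
by rewrite rmorphM ga_lift_mono ga_lift_scal.
Qed.
End FourierTheory.

Definition regular_nat (N : nat) := forall x : U, N%:R * x = 0 -> x = 0.

(** Characters with their orthogonality relation, N standing for the order of W. *)
Definition dual_family (W : finZmodType) (K : finType) (th : K -> W -> U) (N : nat) :=
  (forall k, expo_char (th k)) /\ forall w, \sum_k th k w = N%:R * (w == 0)%:R.

(** Fourier inversion recovers N h(w) as the sum of th_k(-w) times the k-th transform of h;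
    regularity of N removes the factor. *)
Lemma ft_inj (W : finZmodType) (K : finType) (th : K -> W -> U) N (f g : grpalg U W) :
  dual_family th N -> regular_nat N -> (forall k, ft (th k) f = ft (th k) g) -> f = g.
Proof.
move=> [thc ths] Nreg fg; apply/eqP; rewrite -subr_eq0; apply/eqP/ffunP => w.
rewrite [RHS]ffunE; apply: Nreg; move: (f - g) (fun k => ftB (thc k) f g) => h hE.
transitivity (\sum_k th k (- w) * ft (th k) h); last first.
  by apply: big1 => k _; rewrite hE fg subrr mulr0.
under eq_bigr => k _ do rewrite /ft mulr_sumr.
rewrite exchange_big /= (bigD1 w) //= [X in _ = _ + X]big1 ?addr0 => [|v vw].
  under eq_bigr => k _ do rewrite mulrCA -(proj2 (thc k)) addNr.
  by rewrite -mulr_sumr ths eqxx mulr1 mulrC.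
under eq_bigr => k _ do rewrite mulrCA -(proj2 (thc k)).
by rewrite -mulr_sumr ths addrC subr_eq0 (negPf vw) !mulr0.
Qed.

Lemma dual_family_prod (W1 W2 : finZmodType) (K1 K2 : finType)
  (t1 : K1 -> W1 -> U) (t2 : K2 -> W2 -> U) N1 N2 :
  dual_family t1 N1 -> dual_family t2 N2 ->
  dual_family (fun (k : K1 * K2) (w : W1 * W2) => t1 k.1 w.1 * t2 k.2 w.2) (N1 * N2).
Proof.
move=> [c1 s1] [c2 s2]; split=> [[k l]|[u v]] /=.
  split=> [|[u v] [u' v']] /=; first by rewrite (proj1 (c1 k)) (proj1 (c2 l)) mulr1.
  by rewrite (proj2 (c1 k)) (proj2 (c2 l)) mulrACA.
rewrite -(pair_bigA _ (fun k l => t1 k u * t2 l v)) /=.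
under eq_bigr do rewrite -mulr_sumr s2.
rewrite -mulr_suml s1 mulrACA -!natrM mulnb xpair_eqE natrM.
by rewrite -!natrM.
Qed.

Lemma regular_natM N1 N2 : regular_nat N1 -> regular_nat N2 -> regular_nat (N1 * N2).
Proof. by move=> r1 r2 x; rewrite natrM -mulrA => /r1/r2. Qed.
End Fourier.

Lemma Zp_unit n (j : 'I_n.+2) : prime n.+2 -> j != 0 -> j \is a GRing.unit.
Proof.
move=> p_prime v0; have := @unitZpE n.+2 j isT; rewrite natr_Zp => ->.
rewrite prime_coprime //.
apply: contra v0 => /dvdnP[q vq]; apply/eqP/val_inj => /=.
by have := ltn_ord j; rewrite vq; case: q {vq} => // q; rewrite mulSn; lia.
Qed.

Section RootOfUnity.
Variables (n : nat) (U : comPzRingType) (z : U).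
Hypothesis p_prime : prime n.+2.
Hypothesis z_sum : \sum_(k < n.+2) z ^+ k = 0.
Local Notation V := 'I_n.+2.
Local Notation p := n.+2.

Lemma zeta_exp : z ^+ p = 1.
Proof. by apply/eqP; rewrite -subr_eq0 subrX1 z_sum mulr0. Qed.

Definition chr (k v : V) : U := z ^+ (k * v).

Lemma chr_char k : expo_char (chr k).
Proof.
split=> [|u v]; first by rewrite /chr muln0.
rewrite /chr -exprD -mulnDr -(expr_mod (k * (u + v)) zeta_exp).
by rewrite -modnMmr (expr_mod _ zeta_exp).
Qed.

Lemma chrC k v : chr k v = chr v k. Proof. by rewrite /chr mulnC. Qed.

Lemma chrDl k l v : chr (k + l) v = chr k v * chr l v.
Proof. by rewrite !(chrC _ v) (proj2 (chr_char v)). Qed.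

Lemma chr0l v : chr 0 v = 1. Proof. by rewrite /chr mul0n. Qed.

Lemma chr_sum v : \sum_k chr k v = p%:R * (v == 0)%:R.
Proof.
have [->|v0] := eqVneq v 0.
  under eq_bigr do rewrite /chr muln0.
  by rewrite sumr_const card_ord mulr1.
rewrite mulr0 -[RHS]z_sum.
have vU := Zp_unit p_prime v0.
rewrite [RHS](reindex_inj (mulIr vU)); apply: eq_bigr => k _.
by rewrite /chr -(expr_mod _ zeta_exp).
Qed.

Lemma dual_chr : dual_family chr p.
Proof. by split; [exact: chr_char|exact: chr_sum]. Qed.

End RootOfUnity.

(** * The Lagrange resolvent in divided form *)

(** Both sides are ((1 + x)^N - 1) / x, in a form valid when x is a zero divisor. *)
Lemma sum_exp1D (U : comPzRingType) (x : U) N :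
  \sum_(k < N) (1 + x) ^+ k = \sum_(m < N) 'C(N, m.+1)%:R * x ^+ m.
Proof.
elim: N => [|N IHN]; first by rewrite !big_ord0.
rewrite big_ord_recr /= IHN exprDn [RHS]big_ord_recr /= binn mul1r.
rewrite [X in _ + X]big_ord_recr /= subnn expr0 mul1r binn mulr1n addrA.
congr (_ + _); rewrite -big_split; apply: eq_bigr => m _ /=.
by rewrite expr1n mul1r binS natrD mulrDl [X in _ = _ + X]mulr_natl.
Qed.

Section Constants.
Variables (n : nat) (U : comPzRingType) (z : U).
Hypothesis p_prime : prime n.+2.
Hypothesis z_sum : \sum_(k < n.+2) z ^+ k = 0.
Local Notation V := 'I_n.+2.
Local Notation p := n.+2.

Let lam := z - 1.
(* Division-free forms of the quotients
     rho N     = (z^N - 1) / lam,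
     eps       = lam^(p-1) / p,      eta_lam = p / lam^(p-1),
     s0 t      = (sum_(k < p) (1 + lam t)^k) / p,
     as_poly y = ((1 + lam y)^p - 1) / lam^p,
   and the coefficient at g of [elw y] is (sum_(k < p) z^(-gk) (1 + lam y)^k) / p. *)
Definition rho N : U := \sum_(i < N) z ^+ i.
Definition binq m : nat := ('C(n.+2, m.+1) %/ n.+2)%N.
Definition eps : U := - \sum_(m < n.+1) (binq m)%:R * lam ^+ m.
Definition etaq : U := \sum_(m < n) (binq m.+1)%:R * lam ^+ m.
Definition eta_lam : U := - (\sum_(i < n.+1) (- (lam * etaq)) ^+ i - (- etaq) ^+ n.+1 * p%:R).
Definition s0 (t : U) : U :=
  \sum_(m < n.+1) (binq m)%:R * lam ^+ m * t ^+ m + eps * t ^+ n.+1.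
Definition as_poly (y : U) : U := eta_lam * y * s0 y.
Definition elw (y : U) : grpalg U V :=
  [ffun g : V => s0 (z ^+ (- g : V)%R * y + rho (- g : V)%R)].

Lemma lam_rho N : lam * rho N = z ^+ N - 1.
Proof. by rewrite subrX1. Qed.

Lemma binqE m : (m < n.+1)%N -> (p * binq m)%N = 'C(p, m.+1).
Proof.
by move=> mn; rewrite /binq mulnC divnK // prime_dvd_bin.
Qed.

(** Expand sum_k (1 + lam)^k = 0 in powers of lam: the top coefficient is 1 and p divides all the
    others. *)
Lemma lam_eps : lam ^+ n.+1 = p%:R * eps.
Proof.
have : \sum_(k < p) (1 + lam) ^+ k = 0 by rewrite /lam addrC subrK.
rewrite sum_exp1D big_ord_recr /= binn mul1r => /eqP; rewrite addrC addr_eq0.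
move/eqP ->; rewrite /eps mulrN mulr_sumr; congr (- _); apply: eq_bigr => m _.
by rewrite -binqE // natrM mulrA.
Qed.

Lemma s0E t : p%:R * s0 t = \sum_(k < p) (1 + lam * t) ^+ k.
Proof.
rewrite sum_exp1D [RHS]big_ord_recr /= binn mul1r exprMn lam_eps mulrDr mulrA.
congr (_ + _); rewrite mulr_sumr; apply: eq_bigr => m _.
by rewrite -binqE // natrM exprMn; ring.
Qed.

Lemma eps_etaq : eps = - (1 + lam * etaq).
Proof.
rewrite /eps big_ord_recl /= mulr1 /binq bin1 divnn /=; congr (- (_ + _)).
by rewrite mulr_sumr; apply: eq_bigr => m _; rewrite exprS mulrCA.
Qed.

(** [eta_lam] is the inverse of [eps] = -(1 + lam etaq). The geometric series for 1 / (1 + lam etaq)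
    is cut at the power p - 1, where lam^(p-1) = p eps; the term in p of [eta_lam] compensates
    exactly for the remainder. *)
Lemma etaE : p%:R = eta_lam * lam ^+ n.+1.
Proof.
have e1 : (- (lam * etaq)) ^+ n.+1 = (- etaq) ^+ n.+1 * (p%:R * eps).
  by rewrite -lam_eps -mulrN exprMn mulrC.
have e2 := subrX1 (- (lam * etaq)) n.+1; rewrite e1 in e2.
rewrite lam_eps /eta_lam; move: e2; set x := \sum_(i < _) _ => e2.
have e3 : eps = - (lam * etaq) - 1 by rewrite eps_etaq opprD addrC.
rewrite -e3 in e2.
transitivity (p%:R * ((- etaq) ^+ n.+1 * (p%:R * eps) - eps * x)); last by ring.
by rewrite -e2; ring.
Qed.

(** For u = 1 + lam y, u^p - 1 is u - 1 = lam y times the sum of the powers of u, which is p s0(y);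
    then p is replaced by eta_lam lam^(p-1). *)
Lemma as_polyE y : (1 + lam * y) ^+ p = 1 + lam ^+ p * as_poly y.
Proof.
have e := subrX1 (1 + lam * y) p.
have e1 : 1 + lam * y - 1 = lam * y by ring.
rewrite e1 -s0E etaE in e.
by rewrite -[LHS](subrK 1) e /as_poly [lam ^+ p]exprS; ring.
Qed.

(** This explains the argument of [s0] in [elw]: the affine substitution multiplies 1 + lam y by
    z^(-g), as the inverse Fourier transform at g requires. *)
Lemma elw_arg (g : V) y :
  1 + lam * (z ^+ (- g : V)%R * y + rho (- g : V)%R) = z ^+ (- g : V)%R * (1 + lam * y).
Proof. by rewrite mulrDr lam_rho; ring. Qed.

Hypothesis p_reg : regular_nat U p.

(** After multiplication by p the coefficients of [elw] become honest sums, and orthogonality of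
    characters selects the term l = k. *)
Lemma ft_elw y (k : V) : ft (chr z k) (elw y) = (1 + lam * y) ^+ k.
Proof.
set u := 1 + lam * y; apply/eqP; rewrite -subr_eq0; apply/eqP/p_reg.
rewrite mulrBr /ft mulr_sumr.
transitivity (\sum_g \sum_(l < p) chr z (k - l) g * u ^+ l - p%:R * u ^+ k).
  congr (_ - _); apply: eq_bigr => g _; rewrite mulrA ffunE s0E elw_arg mulr_suml.
  apply: eq_bigr => l _; rewrite exprMn -exprM mulrAC; congr (_ * _).
  rewrite (chrDl z_sum) mulrC; congr (_ * _).
  have := chrDl z_sum (- l) l (-g); rewrite addNr chr0l => e1.
  have e2 := chrDl z_sum l (-l) g; have e3 : chr z l (-g) * chr z l g = 1.
    by rewrite -(proj2 (chr_char z_sum l)) addNr (proj1 (chr_char z_sum l)).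
  have e4 : chr z (-l) g * chr z l g = 1.
    by rewrite -chrDl // addNr chr0l.
  rewrite -[z ^+ _]/(z ^+ ((- g : V)%R * l)) mulnC -[LHS]/(chr z l (- g)).
  by rewrite -[LHS]mulr1 -e4 [chr z (-l) g * _]mulrC mulrA e3 mul1r.
rewrite exchange_big /=.
under eq_bigr => l _.
  under eq_bigr do rewrite chrC.
  rewrite -mulr_suml (chr_sum p_prime z_sum) subr_eq0; over.
rewrite (bigD1 k) //= big1 => [|l lk].
  by rewrite eqxx mulr1 addr0 subrr.
by rewrite eq_sym (negPf lk) mulr0 mul0r.
Qed.

End Constants.

(** * The carry cocycle of Z/p and the element with that Fourier transform *)

Definition carry n (k l : 'I_n.+2) : bool := (n.+2 <= k + l)%N.

Lemma carryE n (k l : 'I_n.+2) :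
  (k + l = carry k l * n.+2 + (k + l : 'I_n.+2)%R)%N.
Proof.
have -> : (k + l : 'I_n.+2)%R = ((k + l) %% n.+2)%N :> nat by [].
have := ltn_ord k; have := ltn_ord l; rewrite /carry; case: (leqP n.+2 (k + l)) => kl lp kp.
  have -> : ((k + l) %% n.+2 = k + l - n.+2)%N.
    have e : (k + l = k + l - n.+2 + n.+2)%N by lia.
    by rewrite [in LHS]e modnDr modn_small //; lia.
  by lia.
by rewrite modn_small // mul0n.
Qed.

Lemma carryC n (k l : 'I_n.+2) : carry k l = carry l k.
Proof. by rewrite /carry addnC. Qed.

(** Multiplied by p, both sides equal k + l + m minus its residue. *)
Lemma carry_assoc n (k l m : 'I_n.+2) :
  (carry k l + carry (k + l)%R m = carry l m + carry k (l + m)%R)%N.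
Proof.
have e1 := carryE k l; have e2 := carryE (k + l)%R m.
have e3 := carryE l m; have e4 := carryE k (l + m)%R.
rewrite addrA in e4.
apply/eqP; rewrite -(eqn_pmul2r (ltn0Sn n.+1)) !mulnDl; apply/eqP.
move: e1 e2 e3 e4; rewrite -!/(muln _ _).
do 4 move: (nat_of_bool _ * n.+2)%N => ?.
move: (nat_of_ord (k + l)%R) (nat_of_ord (l + m)%R) (nat_of_ord (k + l + m)%R).
by move=> *; lia.
Qed.

Definition coboundary (U : comPzRingType) (V : finZmodType) (b : grpalg U V) :
    grpalg U (V * V)%type :=
  ga_push U (@pr_l V) b + ga_push U (@pr_r V) b - ga_push U (@pr_d V) b.

Section AbstractKappa.
Variables (U : comPzRingType) (V : finZmodType) (th : V -> V -> U) (N : nat).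
Hypothesis th_dual : dual_family th N.
Hypothesis thDl : forall k l v, th (k + l) v = th k v * th l v.
Hypothesis th0l : forall v, th 0 v = 1.
Hypothesis N_reg : regular_nat U N.

Definition th2 (k : V * V) (v : V * V) : U := th k.1 v.1 * th k.2 v.2.
Definition th3 (k : V * V * V) (v : V * V * V) : U := th2 k.1 v.1 * th k.2 v.2.

Lemma dual_th2 : dual_family th2 (N * N).
Proof. exact: dual_family_prod th_dual th_dual. Qed.
Lemma dual_th3 : dual_family th3 (N * N * N).
Proof. exact: dual_family_prod dual_th2 th_dual. Qed.

Lemma eq_ft (W : finZmodType) (t t' : W -> U) f : t =1 t' -> ft t f = ft t' f.
Proof. by move=> tt'; apply: eq_bigr => v _; rewrite tt'. Qed.

Let c1 k := proj1 th_dual k.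
Let c2 k := proj1 dual_th2 k.
Let c3 k := proj1 dual_th3 k.
Let reg2 := regular_natM N_reg N_reg.
Let reg3 := regular_natM reg2 N_reg.

Lemma ft2_l k l (f : grpalg U V) :
  ft (th2 (k, l)) (ga_push U (@pr_l V) f) = ft (th k) f.
Proof.
rewrite (ft_push (c2 _)); apply: eq_ft => v /=.
by rewrite /th2 /= (proj1 (c1 l)) mulr1.
Qed.
Lemma ft2_r k l (f : grpalg U V) :
  ft (th2 (k, l)) (ga_push U (@pr_r V) f) = ft (th l) f.
Proof.
rewrite (ft_push (c2 _)); apply: eq_ft => v /=.
by rewrite /th2 /= (proj1 (c1 k)) mul1r.
Qed.
Lemma ft2_d k l (f : grpalg U V) :
  ft (th2 (k, l)) (ga_push U (@pr_d V) f) = ft (th (k + l)) f.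
Proof.
rewrite (ft_push (c2 _)); apply: eq_ft => v /=.
by rewrite /th2 /= thDl.
Qed.
Lemma ft3_12 k l m f : ft (th3 (k, l, m)) (ga_push U (@pr_12 V) f) = ft (th2 (k, l)) f.
Proof.
rewrite (ft_push (c3 _)); apply: eq_ft => -[u v].
by rewrite /th3 /th2 /= (proj1 (c1 m)) mulr1.
Qed.
Lemma ft3_23 k l m f : ft (th3 (k, l, m)) (ga_push U (@pr_23 V) f) = ft (th2 (l, m)) f.
Proof.
rewrite (ft_push (c3 _)); apply: eq_ft => -[u v].
by rewrite /th3 /th2 /= (proj1 (c1 k)) mul1r.
Qed.
Lemma ft3_d1 k l m f : ft (th3 (k, l, m)) (ga_push U (@pr_d1 V) f) = ft (th2 (k + l, m)) f.
Proof.
rewrite (ft_push (c3 _)); apply: eq_ft => -[u v].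
by rewrite /th3 /th2 /= thDl.
Qed.
Lemma ft3_d2 k l m f : ft (th3 (k, l, m)) (ga_push U (@pr_d2 V) f) = ft (th2 (k, l + m)) f.
Proof.
rewrite (ft_push (c3 _)); apply: eq_ft => -[u v].
by rewrite /th3 /th2 /= thDl mulrA.
Qed.

Variables (b : grpalg U V) (r : U) (c : V -> V -> bool).
Hypothesis ftb : forall k l, ft (th k) b + ft (th l) b - ft (th (k + l)) b = r * (c k l)%:R.
Hypothesis cC : forall k l, c k l = c l k.
Hypothesis c0l : forall l, c 0 l = false.
Hypothesis cA : forall k l m, (c k l + c (k + l)%R m = c l m + c k (l + m)%R)%N.

Local Notation kappa := (coboundary b).

Lemma ft_kappa k l : ft (th2 (k, l)) kappa = r * (c k l)%:R.
Proof. by rewrite /coboundary (ftB (c2 _)) (ftD (c2 _)) ft2_l ft2_r ft2_d ftb. Qed.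

Lemma kappa_swap : ga_push U (@pr_swap V) kappa = kappa.
Proof.
apply: (ft_inj dual_th2 reg2) => -[k l]; rewrite (ft_push (c2 _)) ft_kappa cC -ft_kappa.
by apply: eq_ft => -[u v]; rewrite /th2 /= mulrC.
Qed.

Lemma kappa_snd : ga_push U (@pr_snd V) kappa = 0.
Proof.
apply: (ft_inj th_dual N_reg) => l; rewrite (ft_push (c1 _)) (ft0 (c1 _)).
transitivity (ft (th2 (0, l)) kappa).
  by apply: eq_ft => -[u v]; rewrite /th2 /= th0l mul1r.
by rewrite ft_kappa c0l mulr0.
Qed.

Lemma kappa_assocD :
  ga_push U (@pr_12 V) kappa + ga_push U (@pr_d1 V) kappa =
  ga_push U (@pr_23 V) kappa + ga_push U (@pr_d2 V) kappa.
Proof.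
apply: (ft_inj dual_th3 reg3) => -[[k l] m].
have e1 := etrans (ftD (c3 (k, l, m)) _ _)
  (congr2 +%R (ft3_12 k l m kappa) (ft3_d1 k l m kappa)).
have e2 := etrans (ftD (c3 (k, l, m)) _ _)
  (congr2 +%R (ft3_23 k l m kappa) (ft3_d2 k l m kappa)).
apply: etrans e1 (etrans _ (esym e2)).
by rewrite !ft_kappa -!mulrDr -!natrD cA.
Qed.

Lemma kappa_assocM :
  ga_push U (@pr_12 V) kappa * ga_push U (@pr_d1 V) kappa =
  ga_push U (@pr_23 V) kappa * ga_push U (@pr_d2 V) kappa.
Proof.
apply: (ft_inj dual_th3 reg3) => -[[k l] m].
have e1 := etrans (ftM (c3 (k, l, m)) _ _)
  (congr2 *%R (ft3_12 k l m kappa) (ft3_d1 k l m kappa)).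
have e2 := etrans (ftM (c3 (k, l, m)) _ _)
  (congr2 *%R (ft3_23 k l m kappa) (ft3_d2 k l m kappa)).
apply: etrans e1 (etrans _ (esym e2)).
rewrite !ft_kappa [LHS]mulrACA [RHS]mulrACA -!natrM.
(* For booleans, equality of the sums of two pairs forces equality of their products. *)
congr (_ * _%:R); have := cA k l m.
by case: (c k l); case: (c (k + l) m); case: (c l m); case: (c k (l + m)).
Qed.

(** The Fourier transform of kappa takes only the values 0 and r. *)
Lemma kappa_sq : kappa * kappa = ga_scal r * kappa.
Proof.
apply: (ft_inj dual_th2 reg2) => -[k l].
rewrite [LHS](ftM (c2 _)) [RHS](ftM (c2 _)) (ft_scal (c2 _)) !ft_kappa mulrACA -natrM.
by case: (c _ _); rewrite ?muln0 ?mulr0 ?mul1n ?mulr1.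
Qed.

Lemma resolvent_splits (P : U) (u : V -> U) (w : grpalg U V) :
  (forall k, ft (th k) w = u k) -> u 0 = 1 ->
  (forall k l, u k * u l = (1 + P * (r * (c k l)%:R)) * u (k + l)) ->
  splits (1 + ga_scal P * kappa) w.
Proof.
move=> fw u0 uM; split.
  apply: (ft_inj dual_th2 reg2) => -[k l].
  rewrite [LHS](ftM (c2 _)) [RHS](ftM (c2 _)) (ftD (c2 _)) (ft1 (c2 _)).
  rewrite [X in 1 + X](ftM (c2 _)) (ft_scal (c2 _)).
  by rewrite ft2_l ft2_r ft2_d !fw ft_kappa uM.
by rewrite -u0 -fw; apply: eq_bigr => v _; rewrite th0l mulr1.
Qed.

End AbstractKappa.

Section Kappa.
Variables (n : nat) (U : comPzRingType) (z : U).
Hypothesis p_prime : prime n.+2.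
Hypothesis z_sum : \sum_(k < n.+2) z ^+ k = 0.
Local Notation V := 'I_n.+2.
Local Notation p := n.+2.
Let lam := z - 1.

(* The sum is the inverse of rho z (- j). *)
Definition beta_coef (j : V) : U :=
  eps n z * \sum_(t < ((- j)^-1 : V)%R) (z ^+ (- j : V)%R) ^+ t.

(** The inverse Fourier transform of k -> eps lam k on the representatives 0, ..., p - 1; the
    failure of this function to be additive is the carry. Subtracting 1 makes the transform vanish
    at k = 0. *)
Definition beta : grpalg U V :=
  \sum_(j | j != 0) ga_scal (beta_coef j) * (ga_mono j - 1).

Lemma rhoD a b : rho z (a + b) = rho z a + z ^+ a * rho z b.
Proof.
rewrite /rho big_split_ord; congr (_ + _).
by rewrite mulr_sumr; apply: eq_bigr => i _; rewrite exprD.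
Qed.

Lemma rhoM a b : rho z (a * b) = (\sum_(t < b) (z ^+ a) ^+ t) * rho z a.
Proof.
elim: b => [|b IHb]; first by rewrite muln0 /rho !big_ord0 mul0r.
by rewrite mulnS addnC rhoD IHb big_ord_recr /= mulrDl exprM.
Qed.

Lemma rho_mod a : rho z a = rho z (a %% p).
Proof.
rewrite {1}(divn_eq a p) rhoD mulnC rhoM exprM (zeta_exp z_sum) expr1n mul1r.
by rewrite [rho z p]z_sum mulr0 add0r.
Qed.

Lemma beta_coefE (j : V) : j != 0 -> beta_coef j * (1 - z ^+ j) = eps n z * lam * z ^+ j.
Proof.
move=> j0; have uj : - j \is a GRing.unit by apply: Zp_unit; rewrite ?oppr_eq0.
have zj : z ^+ (- j : V)%R * z ^+ j = 1.
  have e := chrDl z_sum (- j) j 1.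
  by rewrite addNr /chr mul0n !muln1 in e.
have -> : 1 - z ^+ j = lam * rho z (- j : V)%R * z ^+ j.
  by rewrite lam_rho mulrBl zj mul1r.
rewrite /beta_coef; set S := \sum_(_ < _) _.
transitivity (eps n z * lam * z ^+ j * (S * rho z (- j : V)%R)); first by ring.
rewrite -rhoM rho_mod.
have -> : ((- j : V)%R * ((- j)^-1 : V)%R %% p)%N = ((- j) * (- j)^-1 : V)%R by [].
by rewrite divrr // /rho /= modn_small // big_ord1 mulr1.
Qed.

(** Induction on k. By [beta_coefE] the increment from k to k + 1 is - eps lam times the sum over j
    <> 0 of z^((k+1) j), and that sum is -1. *)
Lemma ft_beta (k : V) : ft (chr z k) beta = eps n z * lam * k%:R.
Proof.
have ftE (i : V) : ft (chr z i) beta = \sum_(j | j != 0) beta_coef j * (z ^+ (i * j) - 1).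
  rewrite /beta !(ft_liftE (chr_char z_sum i)) rmorph_sum; apply: eq_bigr => j _.
  by rewrite rmorphM rmorphB rmorph1 ga_lift_scal ga_lift_mono.
suff ftn (i : nat) : (i < p)%N ->
    \sum_(j : V | j != 0) beta_coef j * (z ^+ (i * j) - 1) = eps n z * lam * i%:R.
  by rewrite ftE ftn.
elim: i => [|i IHi] ip.
  by rewrite mulr0 big1 // => j _; rewrite mul0n subrr mulr0.
rewrite -natr1 mulrDr -IHi 1?ltnW // mulr1.
apply/eqP; rewrite addrC -subr_eq -sumrB; apply/eqP.
transitivity (\sum_(j : V | j != 0) - (eps n z * lam) * chr z (inord i.+1) j).
  apply: eq_bigr => j j0; rewrite /chr inordK //.
  transitivity (- (beta_coef j * (1 - z ^+ j)) * z ^+ (i * j)).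
    by rewrite mulSn exprD; ring.
  by rewrite beta_coefE // mulSn exprD; ring.
rewrite -mulr_sumr; have := chr_sum p_prime z_sum (inord i.+1).
rewrite (bigD1 0) //= {1}/chr mul0n expr0.
have -> : (inord i.+1 == 0 :> V) = false by apply/negbTE; rewrite -val_eqE /= inordK.
rewrite mulr0 => /eqP; rewrite addrC addr_eq0 => /eqP e.
transitivity (- (eps n z * lam) * (\sum_(i0 : V | i0 != 0) chr z i0 (inord i.+1))).
  by congr (_ * _); apply: eq_bigr => j _; rewrite chrC.
by rewrite e mulrNN mulr1.
Qed.


(** On a carry, k + l exceeds its residue by p, and p eps lam = lam^p. *)
Lemma ft_beta_carry (k l : V) :
  ft (chr z k) beta + ft (chr z l) beta - ft (chr z (k + l)) beta =
  lam ^+ p * (carry k l)%:R.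
Proof.
have e : k%:R + l%:R - (k + l : V)%R%:R = (carry k l)%:R * p%:R :> U.
  by rewrite -natrD carryE natrD addrK natrM.
rewrite !ft_beta; transitivity (eps n z * lam * (k%:R + l%:R - (k + l : V)%R%:R)).
  by ring.
by rewrite e exprS (lam_eps p_prime z_sum); ring.
Qed.

Hypothesis p_reg : regular_nat U p.

Lemma elw_splits y :
  splits (1 + ga_scal (as_poly n z y) * coboundary beta) (elw n z y).
Proof.
pose u (k : V) := (1 + lam * y) ^+ k.
have uM (k l : V) : u k * u l =
    (1 + as_poly n z y * (lam ^+ p * (carry k l)%:R)) * u (k + l).
  rewrite /u -exprD carryE exprD [(_ * p)%N]mulnC exprM; congr (_ * _).
  case: (carry k l); last by rewrite !mulr0 addr0 expr0.
  by rewrite expr1 (as_polyE p_prime z_sum) mulr1 mulrC.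
have := @resolvent_splits U V (chr z) p (dual_chr p_prime z_sum) (chrDl z_sum)
  (fun v => chr0l z v) p_reg beta (lam ^+ p) (@carry n) ft_beta_carry (as_poly n z y) u
  (elw n z y).
apply=> //; exact: (ft_elw p_prime z_sum p_reg).
Qed.

Lemma elw_shift y : elw n z (z * y + 1) = ga_mono 1 * elw n z y.
Proof.
apply: (ft_inj (dual_chr p_prime z_sum) p_reg) => k.
rewrite (ftM (chr_char z_sum _)) !(ft_elw p_prime z_sum p_reg) (ft_mono (chr_char z_sum _)).
have -> : 1 + (z - 1) * (z * y + 1) = z * (1 + (z - 1) * y) by ring.
by rewrite exprMn /chr muln1.
Qed.

Lemma lam_reg (x : U) : lam ^+ p * x = 0 -> x = 0.
Proof.
(* Two factors p are used because p is only a multiple of lam^(p-1), whereas p^2 is a multiple of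
   lam^p. *)
move=> lx; apply: p_reg; apply: p_reg; rewrite !(etaE p_prime z_sum).
transitivity (eta_lam n z ^+ 2 * lam ^+ n * (lam ^+ p * x)); last by rewrite lx mulr0.
rewrite -/lam !exprS; ring.
Qed.

(** The substitution multiplies 1 + lam y by z, which does not change its p-th power; lam^p is then
    cancelled. *)
Lemma as_poly_shift y : as_poly n z (z * y + 1) = as_poly n z y.
Proof.
apply/eqP; rewrite -subr_eq0; apply/eqP/lam_reg; rewrite mulrBr.
have e1 := as_polyE p_prime z_sum y; have e2 := as_polyE p_prime z_sum (z * y + 1).
have e3 : 1 + (z - 1) * (z * y + 1) = z * (1 + (z - 1) * y) by ring.
rewrite e3 exprMn (zeta_exp z_sum) mul1r e1 in e2.
by move: e2 => /addrI ->; rewrite subrr.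
Qed.

End Kappa.

(** * The elementary cocycles *)

Lemma ga_push_coef (R R' : comPzRingType) (V W : finZmodType) (phi : {additive V -> W})
  (h : {rmorphism R -> R'}) (f : grpalg R V) :
  ga_push R' phi (ga_coef V h f) = ga_coef W h (ga_push R phi f).
Proof.
apply/ffunP => w; rewrite ga_coefE !ga_mapE rmorph_sum; apply: eq_bigr => v _ /=.
by rewrite ga_coefE.
Qed.

Lemma ga_coef_scal (R R' : comPzRingType) (V : finZmodType)
  (h : {rmorphism R -> R'}) r : ga_coef V h (ga_scal r) = ga_scal (h r).
Proof. exact: ga_map_scal. Qed.

Lemma ga_coef_mono (R R' : comPzRingType) (V : finZmodType)
  (h : {rmorphism R -> R'}) v : ga_coef V h (ga_mono v) = ga_mono v.
Proof. exact: ga_map_mono. Qed.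

Lemma ga_coef_coboundary (R R' : comPzRingType) (V : finZmodType)
  (h : {rmorphism R -> R'}) (b : grpalg R V) :
  ga_coef (V * V)%type h (coboundary b) = coboundary (ga_coef V h b).
Proof. by rewrite /coboundary rmorphB rmorphD -!ga_push_coef. Qed.

Lemma splits_coef (R R' : comPzRingType) (V : finZmodType)
  (h : {rmorphism R -> R'}) C (w : grpalg R V) :
  splits C w -> splits (ga_coef (V * V)%type h C) (ga_coef V h w).
Proof.
move=> [sw w1]; split; first by rewrite !ga_push_coef -!rmorphM sw.
by rewrite -(rmorph1 h) -w1 rmorph_sum; apply: eq_bigr => v _; rewrite ga_coefE.
Qed.

Section LinearCocycle.
Variables (T : comPzRingType) (V : finZmodType) (ka : grpalg T (V * V)%type) (r a : T).
Hypothesis ka_swap : ga_push T (@pr_swap V) ka = ka.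
Hypothesis ka_snd : ga_push T (@pr_snd V) ka = 0.
Hypothesis ka_assocD :
  ga_push T (@pr_12 V) ka + ga_push T (@pr_d1 V) ka =
  ga_push T (@pr_23 V) ka + ga_push T (@pr_d2 V) ka.
Hypothesis ka_assocM :
  ga_push T (@pr_12 V) ka * ga_push T (@pr_d1 V) ka =
  ga_push T (@pr_23 V) ka * ga_push T (@pr_d2 V) ka.
Hypothesis ka_sq : ka * ka = ga_scal r * ka.
Hypothesis ra_unit : invertible (1 + r * a).

Let lin_push (W : finZmodType) (phi : {additive (V * V)%type -> W}) :
  ga_push T phi (1 + ga_scal a * ka) = 1 + ga_scal a * ga_push T phi ka.
Proof. by rewrite rmorphD rmorph1 rmorphM ga_map_scal. Qed.

(** A product (1 + a x)(1 + a y) depends only on x + y and x y, which is why the cocycle identity of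
    [ka] is assumed in additive and in multiplicative form. *)
Lemma linear_cocycle : exists C : cocycle T V, cc C = 1 + ga_scal a * ka.
Proof.
have s1 : ga_push T (@pr_swap V) (1 + ga_scal a * ka) = 1 + ga_scal a * ka.
  by rewrite lin_push ka_swap.
have s2 : ga_push T (@pr_snd V) (1 + ga_scal a * ka) = 1.
  by rewrite lin_push ka_snd mulr0 addr0.
have s3 :
    ga_push T (@pr_12 V) (1 + ga_scal a * ka) * ga_push T (@pr_d1 V) (1 + ga_scal a * ka) =
    ga_push T (@pr_23 V) (1 + ga_scal a * ka) * ga_push T (@pr_d2 V) (1 + ga_scal a * ka).
  rewrite !lin_push.
  move: (ga_scal a) (ga_push T (@pr_12 V) ka) (ga_push T (@pr_d1 V) ka)
    (ga_push T (@pr_23 V) ka) (ga_push T (@pr_d2 V) ka) ka_assocD ka_assocM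
    => A x y x' y' xD xM.
  transitivity (1 + A * (x + y) + A ^+ 2 * (x * y)); first by ring.
  by rewrite xD xM; ring.
have s4 : invertible (1 + ga_scal a * ka).
  (* Since ka^2 = r ka, the product with 1 + a ka is 1 + (a - a v (1 + r a)) ka, and v is the
     inverse of 1 + r a. *)
  have [v rav] := ra_unit; exists (1 - ga_scal (a * v) * ka).
  have e : ga_scal a = ga_scal (a * v) + ga_scal (a * v) * ga_scal a * ga_scal r.
    move=> X; rewrite -!rmorphM -rmorphD; congr ga_scal.
    by rewrite -[LHS]mulr1 -rav; ring.
  rewrite mulrDl mul1r mulrBr mulr1 mulrACA ka_sq.
  rewrite {1}(e (V * V)%type).
  ring.
by exists (Cocycle s1 s2 s3 s4).
Qed.
End LinearCocycle.

(** * Specialization from the universal ring Z[zeta][y] *)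

Section Naturality.
Variables (n : nat) (U T : comPzRingType) (zU : U) (z : T).
Variable F : {rmorphism U -> T}.
Hypothesis Fz : F zU = z.
Local Notation V := 'I_n.+2.

Lemma rmorph_rho N : F (rho zU N) = rho z N.
Proof. by rewrite rmorph_sum; apply: eq_bigr => i _; rewrite rmorphXn Fz. Qed.

Lemma rmorph_lam : F (zU - 1) = z - 1.
Proof. by rewrite rmorphB rmorph1 Fz. Qed.

Lemma rmorph_eps : F (eps n zU) = eps n z.
Proof.
rewrite rmorphN rmorph_sum; congr (- _); apply: eq_bigr => i _.
by rewrite rmorphM rmorphXn rmorph_lam rmorph_nat.
Qed.

Lemma rmorph_etaq : F (etaq n zU) = etaq n z.
Proof.
rewrite rmorph_sum; apply: eq_bigr => i _.
by rewrite rmorphM rmorphXn rmorph_lam rmorph_nat.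
Qed.

Lemma rmorph_eta : F (eta_lam n zU) = eta_lam n z.
Proof.
rewrite rmorphN rmorphB rmorph_sum rmorphM !rmorphXn !rmorphN rmorph_nat rmorph_etaq.
congr (- (_ - _)); apply: eq_bigr => i _.
by rewrite rmorphXn rmorphN rmorphM rmorph_lam rmorph_etaq.
Qed.

Lemma rmorph_s0 t : F (s0 n zU t) = s0 n z (F t).
Proof.
rewrite rmorphD rmorphM rmorphXn rmorph_eps rmorph_sum; congr (_ + _).
apply: eq_bigr => i _.
by rewrite !rmorphM !rmorphXn rmorph_lam rmorph_nat.
Qed.

Lemma rmorph_as_poly y : F (as_poly n zU y) = as_poly n z (F y).
Proof. by rewrite !rmorphM rmorph_eta rmorph_s0. Qed.

Lemma rmorph_elw y : ga_coef V F (elw n zU y) = elw n z (F y).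
Proof.
apply/ffunP => g; rewrite ga_coefE !ffunE rmorph_s0 rmorphD rmorphM rmorphXn Fz.
by rewrite rmorph_rho.
Qed.

Lemma rmorph_beta : ga_coef V F (beta n zU) = beta n z.
Proof.
rewrite rmorph_sum; apply: eq_bigr => j _.
rewrite rmorphM rmorphB rmorph1 ga_coef_scal ga_coef_mono; congr (ga_scal _ * _).
rewrite rmorphM rmorph_eps rmorph_sum; congr (_ * _); apply: eq_bigr => t _.
by rewrite !rmorphXn Fz.
Qed.
End Naturality.

Section PolyEval.
Variables (A : comNzRingType) (T : comPzRingType) (f : {rmorphism A -> T}) (y : T).

Definition pev (q : {poly A}) : T := \sum_(i < size q) f q`_i * y ^+ i.

Lemma pev_widen N (q : {poly A}) : (size q <= N)%N -> pev q = \sum_(i < N) f q`_i * y ^+ i.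
Proof.
move=> qN; rewrite /pev (big_ord_widen N (fun i => f q`_i * y ^+ i)) //.
rewrite big_mkcond; apply: eq_bigr => i _; case: ltnP => // iq.
by rewrite nth_default // rmorph0 mul0r.
Qed.

Lemma pev_zmod : zmod_morphism pev.
Proof.
move=> q r; pose N := maxn (size q) (size r).
rewrite (@pev_widen N q) ?leq_maxl // (@pev_widen N r) ?leq_maxr //.
rewrite (@pev_widen N); last by rewrite (leq_trans (size_polyD _ _)) // size_polyN.
by rewrite -sumrB; apply: eq_bigr => i _; rewrite coefB rmorphB mulrBl.
Qed.

Lemma pevD q r : pev (q + r) = pev q + pev r.
Proof.
have e := pev_zmod (q + r) r; rewrite addrK in e.
by rewrite e subrK.
Qed.

Lemma pevMX q : pev (q * 'X) = pev q * y.
Proof.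
rewrite (@pev_widen (size q).+1); last first.
  by have [->|q0] := eqVneq q 0; rewrite ?mul0r ?size_poly0 // size_mulX.
rewrite big_ord_recl coefMX /= rmorph0 mul0r add0r mulr_suml; apply: eq_bigr => i _.
by rewrite coefMX /= /bump /= add1n exprSr mulrA.
Qed.

Lemma pevCM c q : pev (c%:P * q) = f c * pev q.
Proof.
rewrite (@pev_widen (size q)); last first.
  by rewrite mul_polyC size_scale_leq.
by rewrite mulr_sumr; apply: eq_bigr => i _; rewrite coefCM rmorphM mulrA.
Qed.

Lemma pevC c : pev c%:P = f c.
Proof.
rewrite (@pev_widen 1) ?size_polyC_leq1 // big_ord1 coefC eqxx mulr1; by [].
Qed.

Lemma pev_monoid : monoid_morphism pev.
Proof.
split=> [|q r]; first by rewrite -polyC1 pevC rmorph1.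
elim/poly_ind: q => [|q c IHq].
  by rewrite mul0r -polyC0 pevC rmorph0 mul0r.
rewrite mulrDl pevD mulrAC pevMX IHq pevCM pevD pevMX pevC; ring.
Qed.

Lemma poly_eval_ex : exists F : {rmorphism {poly A} -> T},
  F 'X = y /\ forall c, F c%:P = f c.
Proof.
pose F : {rmorphism {poly A} -> T} := HB.pack pev
  (GRing.isZmodMorphism.Build _ _ pev pev_zmod)
  (GRing.isMonoidMorphism.Build _ _ pev pev_monoid).
exists F; split; last exact: pevC.
by rewrite -['X]mul1r [LHS]pevMX -polyC1 pevC rmorph1 mul1r.
Qed.
End PolyEval.

Lemma cyc_int_neq0 n : (1 : cyc n int) != 0.
Proof.
apply/eqP => /(congr1 (fun x : cyc n int => cco x 0)).
by rewrite /cco cyc1 (_ : cyc_mx 0 = 0) // !mxE.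
Qed.

HB.instance Definition _ n :=
  GRing.PzSemiRing_isNonZero.Build (cyc n int) (cyc_int_neq0 n).

Lemma cyc_int_regular n N : (0 < N)%N -> regular_nat (cyc n int) N.
Proof.
move=> N0 x Nx; apply: cyc_ext => i.
have : cco (N%:R * x) i = cco (0 : cyc n int) i by rewrite Nx.
rewrite -(rmorph_nat cscal) cco_scalM {2}/cco (_ : cyc_mx 0 = 0) // mxE => /eqP.
rewrite mulf_eq0 Num.Theory.pnatr_eq0 eqn0Ngt N0 /= => /eqP ->.
by rewrite /cco (_ : cyc_mx 0 = 0) // mxE.
Qed.

Lemma poly_regular (A : comNzRingType) N : regular_nat A N -> regular_nat {poly A} N.
Proof.
move=> rA q Nq; apply/polyP => i; rewrite coef0; apply: rA.
by rewrite mulr_natl -coefMn -mulr_natl Nq coef0.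
Qed.

Lemma rmorph_eqD (X Y : comPzRingType) (h : {rmorphism X -> Y}) (a b c d : X) :
  a + b = c + d -> h a + h b = h c + h d.
Proof. by move=> e; rewrite -!rmorphD e. Qed.

Lemma rmorph_eqM (X Y : comPzRingType) (h : {rmorphism X -> Y}) (a b c d : X) :
  a * b = c * d -> h a * h b = h c * h d.
Proof. by move=> e; rewrite -!rmorphM e. Qed.

(** The identities of [ka] are provable over U, where p is regular; in T only the invertibility of 1
    + F(r) a has to be known, and a need not come from U. *)
Lemma linear_cocycle_coef (U T : comPzRingType) (V : finZmodType) (F : {rmorphism U -> T})
    (ka : grpalg U (V * V)%type) (r : U) (a : T) :
  ga_push U (@pr_swap V) ka = ka -> ga_push U (@pr_snd V) ka = 0 ->
  ga_push U (@pr_12 V) ka + ga_push U (@pr_d1 V) ka =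
    ga_push U (@pr_23 V) ka + ga_push U (@pr_d2 V) ka ->
  ga_push U (@pr_12 V) ka * ga_push U (@pr_d1 V) ka =
    ga_push U (@pr_23 V) ka * ga_push U (@pr_d2 V) ka ->
  ka * ka = ga_scal r * ka -> invertible (1 + F r * a) ->
  exists C : cocycle T V, cc C = 1 + ga_scal a * ga_coef (V * V)%type F ka.
Proof.
move=> k1 k2 k3 k4 k5.
have e (W : finZmodType) (phi : {additive (V * V)%type -> W}) := esym (ga_push_coef phi F ka).
apply: linear_cocycle.
- by rewrite ga_push_coef k1.
- by rewrite ga_push_coef k2 rmorph0.
- exact: etrans (esym (congr2 +%R (e _ (@pr_12 V)) (e _ (@pr_d1 V))))
    (etrans (rmorph_eqD (ga_coef (V * V * V)%type F) k3)
    (congr2 +%R (e _ (@pr_23 V)) (e _ (@pr_d2 V)))).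
- exact: etrans (esym (congr2 *%R (e _ (@pr_12 V)) (e _ (@pr_d1 V))))
    (etrans (rmorph_eqM (ga_coef (V * V * V)%type F) k4)
    (congr2 *%R (e _ (@pr_23 V)) (e _ (@pr_d2 V)))).
- by rewrite -rmorphM k5 rmorphM ga_coef_scal.
Qed.

Section ElementaryCocycle.
Variables (n : nat) (R : comPzRingType).
Hypothesis p_prime : prime n.+2.
Local Notation V := 'I_n.+2.
Local Notation p := n.+2.
Local Notation T := (cyc n R).
Local Notation U := {poly (cyc n int)}.
Local Notation zT := (zt : T).
Local Notation zU := ((zt : cyc n int)%:P).

Let zU_sum : \sum_(k < p) zU ^+ k = 0.
Proof.
transitivity ((\sum_(k < p) (zt : cyc n int) ^+ k)%:P); last first.
  by rewrite zt_sum.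
by rewrite rmorph_sum; apply: eq_bigr => i _; rewrite rmorphXn.
Qed.

Let U_reg : regular_nat U p.
Proof. apply: (@poly_regular (cyc n int) p). exact: cyc_int_regular. Qed.

Let ev (y : T) : exists F : {rmorphism U -> T}, F zU = zT /\ F 'X = y.
Proof.
have [F [FX FC]] := poly_eval_ex (cyc_map n (intmul 1 : {rmorphism int -> R})) y.
by exists F; rewrite FC cyc_map_zt.
Qed.

Lemma el_splits (y : T) :
  splits (1 + ga_scal (as_poly n zt y) * coboundary (beta n zt)) (elw n zt y).
Proof.
have [F [Fz FX]] := ev y.
have := splits_coef F (elw_splits p_prime zU_sum U_reg 'X).
rewrite rmorphD rmorph1 rmorphM ga_coef_scal ga_coef_coboundary.
by rewrite (rmorph_beta n Fz) (rmorph_elw n Fz) (rmorph_as_poly n Fz) FX.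
Qed.

Lemma el_shift (y : T) : elw n zt (zt * y + 1) = ga_mono 1 * elw n zt y.
Proof.
have [F [Fz FX]] := ev y.
have := congr1 (ga_coef V F) (elw_shift p_prime zU_sum U_reg 'X).
rewrite rmorphM ga_coef_mono !(rmorph_elw n Fz) rmorphD rmorphM rmorph1 FX Fz.
by [].
Qed.

Lemma el_poly_shift (y : T) : as_poly n zt (zt * y + 1) = as_poly n zt y.
Proof.
have [F [Fz FX]] := ev y.
have := congr1 F (as_poly_shift p_prime zU_sum U_reg 'X).
by rewrite !(rmorph_as_poly n Fz) rmorphD rmorphM rmorph1 FX Fz.
Qed.

Lemma el_cocycle (a : T) : invertible (1 + (zt - 1) ^+ p * a) ->
  exists C : cocycle T V, cc C = 1 + ga_scal a * coboundary (beta n zt).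
Proof.
move=> ua; have [F [Fz _]] := ev 0.
have -> : coboundary (beta n zt) = ga_coef (V * V)%type F (coboundary (beta n zU)).
  by rewrite ga_coef_coboundary (rmorph_beta n Fz).
have dth := dual_chr p_prime zU_sum; have ftb := ft_beta_carry p_prime zU_sum.
have th0 (v : V) : chr zU 0 v = 1 by exact: chr0l.
have c0 (l : V) : carry 0 l = false by rewrite /carry add0n leqNgt ltn_ord.
have k1 := kappa_swap dth (chrDl zU_sum) U_reg ftb (@carryC n).
have k2 := kappa_snd dth (chrDl zU_sum) th0 U_reg ftb c0.
have k3 := kappa_assocD dth (chrDl zU_sum) U_reg ftb (@carry_assoc n).
have k4 := kappa_assocM dth (chrDl zU_sum) U_reg ftb (@carry_assoc n).
have k5 := kappa_sq dth (chrDl zU_sum) U_reg ftb.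
rewrite -(rmorph_lam Fz) -rmorphXn in ua.
exact: linear_cocycle_coef k1 k2 k3 k4 k5 ua.
Qed.

End ElementaryCocycle.

(** * Ideals and traces *)

Section Ideals.
Variable R : comPzRingType.
Implicit Types (I M : set R).

Section IdealOps.
Variable I : set R.
Hypothesis idI : ideal I.

Lemma ideal0 : I 0. Proof. by case: idI. Qed.
Lemma idealD x y : I x -> I y -> I (x + y). Proof. by case: idI => _ + _; apply. Qed.
Lemma ideal_mull a x : I x -> I (a * x). Proof. by case: idI => _ _; apply. Qed.
Lemma ideal_mulr a x : I x -> I (x * a). Proof. by rewrite mulrC; exact: ideal_mull. Qed.
Lemma idealN x : I x -> I (- x). Proof. by rewrite -mulN1r; exact: ideal_mull. Qed.
Lemma idealB x y : I x -> I y -> I (x - y).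
Proof. by move=> Ix Iy; apply: idealD => //; exact: idealN. Qed.
Lemma ideal_sum J (r : seq J) (P : pred J) F :
  (forall i, P i -> I (F i)) -> I (\sum_(i <- r | P i) F i).
Proof. by move=> IF; apply: big_ind => //; [exact: ideal0|exact: idealD]. Qed.

Lemma ideal_det m (A B : 'M[R]_m) :
  (forall i j, I (A i j - B i j)) -> I (\det A - \det B).
Proof.
move=> AB; rewrite -sumrB; apply: ideal_sum => s _; rewrite -mulrBr; apply: ideal_mull.
apply: (big_ind2 (fun x y => I (x - y))) => // [|x x' y y' xx' yy'].
  by rewrite subrr; exact: ideal0.
have -> : x * y - x' * y' = x * (y - y') + y' * (x - x') by ring.
by apply: idealD; exact: ideal_mull.
Qed.
End IdealOps.

Lemma maximal_ideal_ex z : ~ invertible z -> exists2 M : set R, maximal_ideal M & M z.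
Proof.
move=> nz; pose good I := [/\ ideal I, ~ I 1 & I z].
pose P : set (set R) := fun X => X = set0 \/ good X.
have [|A [PA maxA]] := @Zorn_bigcup R P.
  move=> F FP totF; have [[X [FX [x Xx]]]|noX] := pselect (exists X, F X /\ exists x, X x).
    right; have goodF Y y : F Y -> Y y -> good Y.
      by move=> FY Yy; case: (FP _ FY) => // Y0; rewrite Y0 in Yy.
    have [[X0 XD XM] X1 Xz] := goodF _ _ FX Xx; split; last by exists X.
      split; first by exists X.
        move=> a b [Y FY Ya] [Z FZ Zb].
        have [[_ YD _] _ _] := goodF _ _ FY Ya; have [[_ ZD _] _ _] := goodF _ _ FZ Zb.
        by case: (totF _ _ FY FZ) => YZ; [exists Z|exists Y] => //;
          [apply: ZD => //; exact: YZ|apply: YD => //; exact: YZ].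
      move=> a b [Y FY Yb]; have [[_ _ YM] _ _] := goodF _ _ FY Yb.
      by exists Y => //; exact: YM.
    by move=> [Y FY Y1]; have [_ + _] := goodF _ _ FY Y1.
  left; rewrite -subset0 => x [X FX Xx]; apply: noX.
  by exists X; split => //; exists x.
have good_z : good (fun x => exists a, x = a * z).
  split; last by exists 1; rewrite mul1r.
    split; first by exists 0; rewrite mul0r.
      by move=> _ _ [a ->] [b ->]; exists (a + b); rewrite mulrDl.
    by move=> a _ [b ->]; exists (a * b); rewrite mulrA.
  by move=> [a e]; apply: nz; exists a; rewrite mulrC.
case: PA => [A0|[idA A1 Az]].
  exfalso; apply: (maxA (fun x => exists a, x = a * z)); last by right.
  by rewrite A0; case: good_z => _ _ gz; split=> [x []|/(_ _ gz)].
exists A => //; split=> // J idJ AJ J1; apply/seteqP; split=> //.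
apply: contrapT => nJA; apply: (maxA J); first by split.
by right; split => //; exact: AJ.
Qed.

Lemma invertible_max x : (forall M : set R, maximal_ideal M -> ~ M x) -> invertible x.
Proof.
by move=> nM; apply: contrapT => /maximal_ideal_ex[M maxM Mx]; exact: nM Mx.
Qed.

Section Maximal.
Variable M : set R.
Hypothesis maxM : maximal_ideal M.

Lemma max_ideal : ideal M. Proof. by case: maxM. Qed.
Lemma max1 : ~ M 1. Proof. by case: maxM. Qed.

Lemma max_inv x : ~ M x -> exists a, M (1 - a * x).
Proof.
move=> nMx; have idM := max_ideal; case: maxM => _ _ maxJ.
pose J y := exists a, M (y - a * x).
have idJ : ideal J.
  split; first by exists 0; rewrite mul0r subrr; exact: ideal0.
    move=> u v [a Ma] [b Mb]; exists (a + b).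
    have -> : u + v - (a + b) * x = u - a * x + (v - b * x) by ring.
    exact: idealD.
  move=> c u [a Ma]; exists (c * a).
  have -> : c * u - c * a * x = c * (u - a * x) by ring.
  exact: ideal_mull.
apply: contrapT => nJ; apply: nMx; rewrite -(maxJ J idJ) //.
  by exists 1; rewrite mul1r subrr; exact: ideal0.
by move=> u Mu; exists 0; rewrite mul0r subr0.
Qed.

Lemma max_prime x y : M (x * y) -> M x \/ M y.
Proof.
move=> Mxy; have idM := max_ideal; have [|/max_inv[a Ma]] := pselect (M x); first by left.
right; have -> : y = (1 - a * x) * y + a * (x * y) by ring.
by apply: idealD => //; [exact: ideal_mulr|exact: ideal_mull].
Qed.

Lemma max_primeX x k : M (x ^+ k) -> M x.
Proof.
elim: k => [/max1//|k IHk]; rewrite exprS => /max_prime[]//.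
Qed.
End Maximal.
End Ideals.

(** * Surjectivity of the trace of a Galois extension *)

Section Trace.
Variables (G : finGroupType) (R : comPzRingType) (S : galgebra G R).
Hypothesis galS : galois S.

Lemma trace_in s : exists r, galg_in S r = \sum_a galg_act S a s.
Proof.
case: galS => _ inv _; apply/inv => b; rewrite rmorph_sum /=.
rewrite [RHS](reindex_inj (mulgI b)); apply: eq_bigr => a _.
by rewrite galg_actM.
Qed.

(** The determinant trick. The traces form an ideal I of R, and the Galois condition gives x_j =
    sum_i tr(y_i x_j) x_i. So A = 1 - (tr(y_i x_j)) kills the vector x, det A kills every x_j and
    hence 1 = sum_i x_i y_i. Thus det A = 0, while det A is 1 modulo I. *)
Lemma trace_one : exists c, \sum_a galg_act S a c = 1.
Proof.
case: (galS) => in_inj inv [m [x [y xy]]].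
pose I : set R := fun r => exists s, galg_in S r = \sum_a galg_act S a s.
have idI : ideal I.
  split; first by exists 0; rewrite rmorph0 big1 // => a _; rewrite rmorph0.
    move=> r r' [s rs] [s' rs']; exists (s + s'); rewrite rmorphD rs rs' -big_split.
    by apply: eq_bigr => a _; rewrite rmorphD.
  move=> r r' [s rs]; exists (galg_in S r * s); rewrite rmorphM rs mulr_sumr.
  by apply: eq_bigr => a _; rewrite rmorphM galg_act_in.
have /boolp.choice[t tE] := trace_in.
pose A : 'M[R]_m := \matrix_(j, i) ((i == j)%:R - t (y i * x j)).
have xE j : x j = \sum_i galg_in S (t (y i * x j)) * x i.
  transitivity (\sum_a galg_act S a (x j) * (a == 1%g)%:R).
    rewrite (bigD1 1%g) //= eqxx mulr1 galg_act1 big1 ?addr0 // => a /negPf ->.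
    by rewrite mulr0.
  under eq_bigr => a _ do rewrite -xy mulr_sumr.
  rewrite exchange_big; apply: eq_bigr => i _; rewrite tE mulr_suml.
  by apply: eq_bigr => a _; rewrite rmorphM; ring.
have Ax : map_mx (galg_in S) A *m (\col_i x i) = 0.
  apply/matrixP => j k; rewrite !mxE.
  under eq_bigr => i _ do rewrite !mxE rmorphB rmorph_nat mulrBl.
  rewrite sumrB -xE (bigD1 j) //= eqxx mul1r big1 ?addr0 ?subrr // => i /negPf ij.
  by rewrite ij mul0r.
have dx j : galg_in S (\det A) * x j = 0.
  have := congr1 (mulmx (\adj (map_mx (galg_in S) A))) Ax.
  rewrite mulmxA mul_adj_mx mulmx0 mul_scalar_mx det_map_mx => /matrixP/(_ j 0).
  by rewrite !mxE.
have dA : \det A = 0.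
  apply: in_inj; rewrite rmorph0 -[LHS]mulr1.
  have <- : \sum_i x i * galg_act S 1%g (y i) = 1 by rewrite xy eqxx.
  rewrite mulr_sumr big1 // => i _.
  by rewrite mulrA dx mul0r.
have : I (\det A - \det (1%:M : 'M[R]_m)).
  apply: ideal_det => // i j; rewrite !mxE eq_sym addrAC subrr add0r.
  by apply: idealN => //; exists (y j * x i).
rewrite dA det1 sub0r => /(idealN idI); rewrite opprK => -[s].
by rewrite rmorph1 => e; exists s.
Qed.
End Trace.

Lemma cyc_monic_nz n (R : comNzRingType) (b : cyc n R) :
  exists c : nat -> R, c n.+1 = 1 /\ \sum_(i < n.+2) cscal (c i) * b ^+ i = 0.
Proof.
have [sz mon] := (size_char_poly (cyc_mx b), char_poly_monic (cyc_mx b)).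
exists (fun i => (char_poly (cyc_mx b))`_i); split.
  by move/monicP: mon; rewrite lead_coefE sz.
apply: cyc_inj; rewrite cyc_sumE.
transitivity (horner_mx (cyc_mx b) (char_poly (cyc_mx b))); last first.
  exact: Cayley_Hamilton.
rewrite -[char_poly _ in RHS]coefK sz poly_def rmorph_sum.
apply: eq_bigr => i _.
by rewrite cycM cycX -mul_polyC rmorphM rmorphXn /= horner_mx_C horner_mx_X.
Qed.

Lemma nonzero_comNzRing (R : comPzRingType) : (1 : R) <> 0 ->
  exists R' : comNzRingType, (R' : comPzRingType) = R.
Proof.
case: R => T [] m1 m2 m3 m4 m5 m6 m7 m8 m9 m10 m11.
set R := GRing.ComPzRing.Pack _ => /eqP R1.
pose R' : comNzRingType := HB.pack (GRing.ComPzRing.sort R)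
  (GRing.PzSemiRing_isNonZero.Build R R1).
by exists R'.
Qed.

Lemma cyc_monic n (R : comPzRingType) (b : cyc n R) : (1 : R) <> 0 ->
  exists c : nat -> R, c n.+1 = 1 /\ \sum_(i < n.+2) cscal (c i) * b ^+ i = 0.
Proof.
move=> R1; have [R' R'E] := nonzero_comNzRing R1.
by move: b; rewrite -R'E; exact: cyc_monic_nz.
Qed.

(** * Ideals of R (x) Z[zeta] and regularity modulo the radical *)

Section Extension.
Variables (n : nat) (R : comPzRingType).
Local Notation D := (cyc n R).

Definition ideal_ext (M : set R) : set D := fun x => forall i, M (cco x i).

Lemma ideal_ext_ideal M : ideal M -> ideal (ideal_ext M).
Proof.
move=> idM; split=> [i|x y Mx My i|a x Mx i].
- by rewrite /cco (_ : cyc_mx 0 = 0) // mxE; exact: ideal0.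
- have -> : cco (x + y) i = cco x i + cco y i by rewrite /cco cycD mxE.
  exact: idealD.
rewrite mulrC /cco cycM mxE; apply: ideal_sum => // k _.
by apply: (ideal_mulr idM); exact: Mx.
Qed.

Lemma cyc_mx_row (x : D) i j : cyc_mx x i j = cco (zt ^+ i * x) j.
Proof.
rewrite /cco cycM cycX mxE (bigD1 i) //= comp_mx_exp_row0 -1?ltnS // eqxx mul1r.
rewrite big1 ?addr0 // => k ki.
by rewrite comp_mx_exp_row0 -1?ltnS // val_eqE (negPf ki) mul0r.
Qed.

(** The rows of the matrix of x are the coordinates of the multiples zt^i x, so all its entries lie
    in M. *)
Lemma nm_ideal_ext M x : ideal M -> ideal_ext M x -> M (nm (1 + x) - 1).
Proof.
move=> idM Mx; rewrite -(nm1 n R); apply: ideal_det => // i j.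
rewrite cycD mxE addrAC subrr add0r cyc_mx_row.
by apply: (ideal_mull (ideal_ext_ideal idM)).
Qed.

(** Modulo M the ring D is finite over a field. Take a monic relation for b and the least k whose
    coefficient c_k is outside M: the relation becomes b^k (c_k + b q) = 0 modulo M, and c_k can be
    divided out. *)
Lemma ext_pi_regular M (b : D) : maximal_ideal M ->
  exists k c, ideal_ext M (b ^+ k * (1 - b * c)).
Proof.
move=> maxM; have idM := max_ideal maxM; have idE := ideal_ext_ideal idM.
have R1 : (1 : R) <> 0 by move=> e; apply: (max1 maxM); rewrite e; exact: ideal0.
have [c [c1 cb]] := cyc_monic b R1.
have exk : exists k, `[< (k < n.+2)%N /\ ~ M (c k) >].
  by exists n.+1; apply/asboolP; split=> //; rewrite c1; exact: max1.
have [k /asboolP[kn Mck] kmin] := ex_minnP exk.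
have scE r (x : D) : M r -> ideal_ext M (cscal r * x).
  by move=> Mr i; rewrite cco_scalM; exact: ideal_mulr.
pose q := \sum_(i < n.+1 - k) cscal (c (k + i.+1)%N) * b ^+ i.
have e1 : ideal_ext M (b ^+ k * (cscal (c k) + b * q)).
  have : ideal_ext M (- \sum_(i < k) cscal (c i) * b ^+ i).
    apply: (idealN idE).
    apply: (ideal_sum idE) => i _; apply: scE; apply: contrapT => Mci.
    have : (k <= i)%N by apply/kmin/asboolP; split=> //; exact: ltn_trans kn.
    by rewrite leqNgt ltn_ord.
  have spl m (F : nat -> D) : m = (k + (n.+1 - k).+1)%N ->
      \sum_(i < m) F i = \sum_(i < k) F i + \sum_(i < (n.+1 - k).+1) F (k + i)%N.
    by move=> ->; rewrite big_split_ord.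
  have := cb; rewrite (spl _ (fun i => cscal (c i) * b ^+ i)); last first.
    by rewrite addnS subnKC.
  move=> /eqP; rewrite addrC addr_eq0 => /eqP <-.
  congr (ideal_ext M _); rewrite big_ord_recl /= addn0 mulrDr mulrC.
  congr (_ + _); rewrite /q mulrA -exprSr mulr_sumr; apply: eq_bigr => i _.
  by rewrite /bump /= add1n mulrCA -exprD addSnnS.
have [u uc] := max_inv maxM Mck.
exists k, (- (cscal u * q)).
have -> : b ^+ k * (1 - b * - (cscal u * q)) =
    cscal u * (b ^+ k * (cscal (c k) + b * q)) + cscal (1 - u * c k) * b ^+ k.
  by rewrite rmorphB rmorphM rmorph1; ring.
by apply: (idealD idE); [exact: (ideal_mull idE)|exact: scE].
Qed.

Hypothesis slR : semilocal R.

(* [cyc n R] modulo its Jacobson radical is von Neumann regular. *)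
Lemma ext_vn_regular (b : D) :
  exists c, forall N : set D, maximal_ideal N -> N b \/ N (1 - b * c).
Proof.
have [s sE] : exists s : seq (set R), forall M, maximal_ideal M -> M \in s.
  have /finite_seqP[s sE] := slR; exists s => M maxM.
  have : [set M : set R | maximal_ideal M]%classic M by [].
  by rewrite sE.
have sgood (l : seq (set R)) : exists k c, forall M, maximal_ideal M -> M \in l ->
    ideal_ext M (b ^+ k * (1 - b * c)).
  elim: l => [|M l [k [c kc]]]; first by exists 0%N, 0.
  have [maxM|nM] := pselect (maximal_ideal M); last first.
    exists k, c => M' maxM'; rewrite inE => /orP[/eqP eM|]; last exact: kc.
    by rewrite eM in maxM'.
  have [k' [c' kc']] := ext_pi_regular b maxM.
  (* Chosen so that 1 - b c'' = (1 - b c)(1 - b c') for the new witness c''; the product then lies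
     in both extended ideals. *)
  exists (k + k')%N, (c + c' - b * c * c') => M' maxM' Ml.
  have idE := ideal_ext_ideal (max_ideal maxM').
  have -> : b ^+ (k + k') * (1 - b * (c + c' - b * c * c')) =
     (b ^+ k * (1 - b * c)) * (b ^+ k' * (1 - b * c')) by rewrite exprD; ring.
  move: Ml; rewrite inE => /orP[/eqP eM|Ml].
    by apply: (ideal_mull idE); rewrite eM.
  by apply: (ideal_mulr idE); exact: kc.
have [k [c kc]] := sgood s; exists c => N maxN; have idN := max_ideal maxN.
set x := b ^+ k * (1 - b * c) in kc.
suff : N x by move/(max_prime maxN) => -[/(max_primeX maxN)|]; [left|right].
apply: contrapT => nNx; have [a Na] := max_inv maxN nNx.
(* Since x lies in the extension of every maximal ideal of R, the norm of 1 - a x is 1 modulo each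
   of them, hence a unit; but 1 - a x lies in N. *)
have : invertible (1 - a * x).
  apply: nm_unit; apply: invertible_max => M maxM Mn; have idM := max_ideal maxM.
  apply: (max1 maxM).
  have : M (nm (1 + - (a * x)) - 1).
    have idE := ideal_ext_ideal idM; apply: nm_ideal_ext => //; apply: (idealN idE).
    by apply: (ideal_mull idE); exact: kc (sE _ maxM).
  by move=> /(idealB idM Mn); rewrite opprB addrC subrK.
by move=> [w aw]; apply: (max1 maxN); rewrite -aw; exact: ideal_mulr.
Qed.

End Extension.

(** * Existence of an invertible resolvent *)

Section UnitResolvent.
Variables (n : nat).
Hypothesis p_prime : prime n.+2.
Local Notation V := 'I_n.+2.
Local Notation p := n.+2.
Variables (G : finGroupType) (io : G -> V) (el : V -> G).
Hypothesis ioM : forall x y, io (x * y)%g = io x + io y.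
Hypothesis elK : cancel el io.
Hypothesis ioK : cancel io el.
Variables (R : comPzRingType) (S : galgebra G R).
Hypothesis galS : galois S.
Hypothesis slR : semilocal R.
Local Notation D := (cyc n R).
Local Notation T := (cyc n S).

Let iota : {rmorphism D -> T} := cyc_map n (galg_in S).
Let sig (v : V) : {rmorphism T -> T} := cyc_map n (galg_act S (el v)).
Let lam : T := zt - 1.

Lemma elD u v : el (u + v) = (el u * el v)%g.
Proof. by rewrite -[RHS]ioK ioM !elK. Qed.

Lemma sigD u v t : sig (u + v) t = sig u (sig v t).
Proof.
by apply: cyc_ext => i; rewrite !cyc_map_co elD galg_actM.
Qed.

Lemma sig_zt v : sig v zt = zt. Proof. exact: cyc_map_zt. Qed.
Lemma sig_iota v d : sig v (iota d) = iota d.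
Proof. by apply: cyc_ext => i; rewrite !cyc_map_co galg_act_in. Qed.
Lemma sig0 t : sig 0 t = t.
Proof.
apply: cyc_ext => i; rewrite cyc_map_co; have -> : el 0 = 1%g by rewrite -[1%g]ioK (io1 ioM).
exact: galg_act1.
Qed.

Lemma iota_inj : injective iota.
Proof.
case: galS => in_inj _ _ x y xy; apply: cyc_ext => i; apply: in_inj.
by rewrite -!cyc_map_co -/iota xy.
Qed.

Lemma sig_invariant t : sig 1 t = t -> exists d, iota d = t.
Proof.
move=> t1.
have tv (k : nat) : sig k%:R t = t.
  by elim: k => [|k IHk]; [exact: sig0|rewrite -natr1 sigD t1].
case: galS => _ inv _.
have /boolp.choice[d dE] i : exists r, galg_in S r = cco t i.
  apply/inv => a; rewrite -[a]ioK -cyc_map_co.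
  by rewrite -[in RHS](tv (io a)) natr_Zp.
exists (\sum_i cscal (d i) * zt ^+ i); apply: cyc_ext => i.
by rewrite cyc_map_co cco_poly dE.
Qed.

Let zp : zt ^+ p = 1 :> T. Proof. exact: zeta_exp (zt_sum n S). Qed.

Lemma zt_expV (v : V) : zt ^+ (- v : V)%R * zt ^+ v = 1 :> T.
Proof.
have e := chrDl (zt_sum n S) (- v) v 1.
by rewrite addNr /chr mul0n !muln1 in e.
Qed.

Lemma zt_expD1 (v : V) : zt ^+ (v + 1 : V)%R = zt ^+ v * zt :> T.
Proof.
have e := chrDl (zt_sum n S) v 1 1.
by rewrite /chr !muln1 /= in e.
Qed.

(** A twisted additive Hilbert 90: for c of trace 1 take y = sum_v rho(-v) sigma^v(c) and use rho(1
    + u) = 1 + zeta rho(u). *)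
Lemma affine_ex : exists y : T, sig 1 y = zt * y + 1.
Proof.
have [c c1] := trace_one galS.
have cS : \sum_v sig v (cscal c) = 1.
  apply: cyc_ext => i; rewrite cco_sum.
  transitivity (cco (cscal (\sum_a galg_act S a c) : T) i); last by rewrite c1 rmorph1.
  rewrite rmorph_sum cco_sum (reindex el) /=; last first.
    by exists io => x _; rewrite ?elK ?ioK.
  by apply: eq_bigr => v _; rewrite cyc_map_scal.
exists (\sum_(v : V) rho (zt : T) (- v : V)%R * sig v (cscal c)).
rewrite rmorph_sum -[1 in RHS]cS mulr_sumr -big_split /=.
rewrite [RHS](reindex_inj (addrI 1)); apply: eq_bigr => v _.
rewrite rmorphM sigD; have -> : sig 1 (rho zt (- v : V)%R) = rho zt (- v : V)%R.
  by rewrite (rmorph_rho (sig_zt 1)).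
rewrite mulrA -[X in _ = _ + X]mul1r -mulrDl; congr (_ * _).
have -> : - v = (1 + - (1 + v)) by rewrite opprD addrA subrr add0r.
set u := - (1 + v).
have -> : rho (zt : T) (1 + u : V)%R = rho zt (1 + u)%N.
  by rewrite [RHS](rho_mod (zt_sum n S)).
by rewrite rhoD /rho big_ord1 expr0 expr1 addrC.
Qed.

(** Lagrange resolvents, for opposite characters, of the elements given by the Galois condition.
    That condition leaves only the p diagonal terms of the double sum, each equal to 1. *)
Lemma eigen_ex : exists m (x y : 'I_m -> T), (forall i, sig 1 (x i) = zt * x i) /\
  (forall i, zt * sig 1 (y i) = y i) /\ \sum_i x i * y i = p%:R.
Proof.
case: galS => _ _ [m [x [y xy]]].
exists m, (fun i => \sum_(v : V) zt ^+ (- v : V)%R * sig v (cscal (x i))),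
  (fun i => \sum_(v : V) zt ^+ v * sig v (cscal (y i))); split=> [i|].
  rewrite rmorph_sum mulr_sumr [RHS](reindex_inj (addrI 1)); apply: eq_bigr => v _.
  rewrite rmorphM rmorphXn sig_zt sigD mulrA; congr (_ * _).
  have {1}-> : - v = - (1 + v) + 1 by rewrite opprD addrC addrA subrr add0r.
  by rewrite zt_expD1 mulrC.
split=> [i|].
  rewrite rmorph_sum mulr_sumr [RHS](reindex_inj (addrI 1)); apply: eq_bigr => v _.
  rewrite rmorphM rmorphXn sig_zt sigD mulrA; congr (_ * _).
  by rewrite addrC zt_expD1 mulrC.
have xyS w : \sum_i cscal (x i) * sig w (cscal (y i)) = (w == 0)%:R :> T.
  under eq_bigr => i _ do rewrite cyc_map_scal -rmorphM.
  rewrite -rmorph_sum xy rmorph_nat; congr (_%:R).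
  by rewrite -(can_eq ioK) elK (io1 ioM).
transitivity (\sum_(u : V) \sum_(v : V) zt ^+ (- u : V)%R * zt ^+ v *
    sig u (\sum_i cscal (x i) * sig (v - u) (cscal (y i))) : T).
  transitivity (\sum_i \sum_(u : V) \sum_(v : V) zt ^+ (- u : V)%R * zt ^+ v *
      (sig u (cscal (x i)) * sig v (cscal (y i))) : T).
    apply: eq_bigr => i _; rewrite mulr_suml; apply: eq_bigr => u _.
    by rewrite mulr_sumr; apply: eq_bigr => v _; ring.
  rewrite exchange_big; apply: eq_bigr => u _ /=.
  rewrite exchange_big; apply: eq_bigr => v _ /=.
  rewrite rmorph_sum mulr_sumr; apply: eq_bigr => i _.
  by rewrite rmorphM -sigD subrKC.
transitivity (\sum_(u : V) (1 : T)); last by rewrite sumr_const card_ord.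
apply: eq_bigr => u _; rewrite (bigD1 u) //= xyS subrr eqxx rmorph1 zt_expV mulr1.
rewrite big1 ?addr0 // => v vu.
by rewrite xyS subr_eq0 (negPf vu) rmorph0 mulr0.
Qed.

Let lamD : D := zt - 1.
Let iota_lam : iota lamD = lam.
Proof. by rewrite /lamD rmorphB rmorph1 cyc_map_zt. Qed.

Lemma sig_lam v : sig v lam = lam.
Proof. by rewrite rmorphB rmorph1 sig_zt. Qed.

Lemma power_invariant x : sig 1 x = zt * x -> exists d, iota d = x ^+ p.
Proof. by move=> sx; apply: sig_invariant; rewrite rmorphXn sx exprMn zp mul1r. Qed.

Lemma affine_eigen y : sig 1 y = zt * y + 1 ->
  sig 1 (1 + lam * y) = zt * (1 + lam * y).
Proof. by move=> sy; rewrite rmorphD rmorph1 rmorphM sig_lam sy /lam; ring. Qed.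

Lemma eigen_mul x y : sig 1 x = zt * x -> zt * sig 1 y = y -> exists d, iota d = x * y.
Proof.
by move=> sx sy; apply: sig_invariant; rewrite rmorphM sx -{2}sy; ring.
Qed.

(* The multiple of [x] added to [y] vanishes at the maximal ideals where
   1 + lam y is already invertible. *)
Lemma resolvent_step (y x z : T) (v d : D) :
    sig 1 y = zt * y + 1 -> iota v = (1 + lam * y) ^+ p ->
    sig 1 x = zt * x -> zt * sig 1 z = z -> iota d = x * z ->
  exists y' v', [/\ sig 1 y' = zt * y' + 1, iota v' = (1 + lam * y') ^+ p
    & forall N : set D, maximal_ideal N -> N v' -> N v /\ N (lamD * d)].
Proof.
move=> sy vE sx sz dE; have [c cN] := ext_vn_regular slR v.
pose f := 1 - v * c; pose y' := y + iota f * x.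
have sy' : sig 1 y' = zt * y' + 1.
  by rewrite /y' rmorphD rmorphM sig_iota sy sx; ring.
set w := 1 + lam * y in vE; pose w' := 1 + lam * y'.
have sw : sig 1 w = zt * w by exact: affine_eigen.
have sw' : sig 1 w' = zt * w' by exact: affine_eigen.
have [v' v'E] := power_invariant sw'.
have ww : w' = w + iota f * (lam * x) by rewrite /w' /y' /w; ring.
(* The cofactor of f in w'^p - w^p is invariant, so v' and v agree modulo f already in D. *)
have [q qE] : exists q, iota q = lam * x * \sum_(i < p) w' ^+ (p.-1 - i) * w ^+ i.
  apply: sig_invariant; rewrite rmorphM rmorphM sig_lam sx rmorph_sum.
  set Q := \sum_(i < p) w' ^+ _ * _.
  have -> : \sum_(i < p) sig 1 (w' ^+ (p.-1 - i) * w ^+ i) = zt ^+ n.+1 * Q.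
    rewrite mulr_sumr; apply: eq_bigr => i _.
    by rewrite rmorphM !rmorphXn sw sw' !exprMn mulrACA -exprD subnK // -ltnS.
  transitivity (zt ^+ p * (lam * x * Q)); last by rewrite zp mul1r.
  by rewrite [zt ^+ p](exprS _ n.+1); ring.
have vv : v' = v + f * q.
  apply: iota_inj; rewrite rmorphD rmorphM qE v'E vE; apply/eqP.
  rewrite addrC -subr_eq subrXX; apply/eqP.
  have -> : w' - w = iota f * (lam * x) by rewrite ww addrAC subrr add0r.
  by rewrite -!mulrA.
exists y', v'; split=> // N maxN Nv'; have idN := max_ideal maxN.
have Nv : N v.
  case: (cN _ maxN) => // Nf; have -> : v = v' - f * q by rewrite vv addrK.
  by apply: (idealB idN) => //; exact: (ideal_mulr idN).
split=> //.
have [e eE] := eigen_mul sw sz; have [e' e'E] := eigen_mul sw' sz.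
have [nn nnE] : exists nn, iota nn = z ^+ p.
  by apply: sig_invariant; rewrite rmorphXn -[in RHS]sz exprMn zp mul1r.
(* The elements w z and w' z are invariant, and their p-th powers are multiples of v and v'; hence
   both lie in N. *)
have Ne : N e.
  apply: (max_primeX maxN (k := p)); have -> : e ^+ p = nn * v.
    by apply: iota_inj; rewrite rmorphXn eE rmorphM nnE vE exprMn mulrC.
  exact: (ideal_mull idN).
have Ne' : N e'.
  apply: (max_primeX maxN (k := p)); have -> : e' ^+ p = nn * v'.
    by apply: iota_inj; rewrite rmorphXn e'E rmorphM nnE v'E exprMn mulrC.
  exact: (ideal_mull idN).
(* Indeed w' z - w z = f lam x z, with f = 1 - v c. *)
have -> : lamD * d = e' - e + (lamD * d * c) * v.
  apply: iota_inj; rewrite rmorphD rmorphB !rmorphM e'E eE iota_lam dE ww.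
  by rewrite /f rmorphB rmorph1 rmorphM; ring.
by apply: (idealD idN); [exact: (idealB idN)|exact: (ideal_mull idN)].
Qed.

(** After one correction for each i, a maximal ideal N containing v contains every lam d_i, hence
    lam p. But v = 1 + lam^p a keeps lam out of N, and then p as well, because lam^(p-1) = p eps. *)
Lemma unit_resolvent : exists (y : T) (a : D),
  [/\ sig 1 y = zt * y + 1, iota a = as_poly n zt y & invertible (1 + lamD ^+ p * a)].
Proof.
have [y0 sy0] := affine_ex; have [m [x [z [sx [sz xz]]]]] := eigen_ex.
have /boolp.choice[d dE] i := eigen_mul (sx i) (sz i).
have [y [v [sy vE vN]]] : exists y v, [/\ sig 1 y = zt * y + 1, iota v = (1 + lam * y) ^+ p
    & forall N : set D, maximal_ideal N -> N v -> forall i, i \in enum 'I_m -> N (lamD * d i)].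
  elim: (enum 'I_m) => [|i l [y [v [sy vE vN]]]].
    by have [v vE] := power_invariant (affine_eigen sy0); exists y0, v.
  have [y' [v' [sy' v'E v'N]]] := resolvent_step sy vE (sx i) (sz i) (dE i).
  exists y', v'; split=> // N maxN /(v'N _ maxN)[Nv Ni] j.
  by rewrite inE => /orP[/eqP ->//|]; exact: vN.
have [a aE] : exists a, iota a = as_poly n zt y.
  apply: sig_invariant; rewrite (rmorph_as_poly n (sig_zt 1)) sy.
  exact: el_poly_shift.
have va : v = 1 + lamD ^+ p * a.
  apply: iota_inj; rewrite rmorphD rmorph1 rmorphM rmorphXn iota_lam aE vE.
  exact: as_polyE p_prime (zt_sum n S) y.
exists y, a; split=> //; rewrite -va; apply: invertible_max => N maxN Nv.
have idN := max_ideal maxN.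
have nNlam : ~ N lamD.
  move=> Nl; apply: (max1 maxN); have -> : 1 = v - lamD * (lamD ^+ n.+1 * a).
    by rewrite va mulrA -exprS addrK.
  by apply: (idealB idN) => //; exact: (ideal_mulr idN).
have : N (lamD * p%:R).
  have -> : p%:R = \sum_i d i.
    apply: iota_inj; rewrite rmorph_nat -xz rmorph_sum; apply: eq_bigr => i _.
    by rewrite dE.
  rewrite mulr_sumr; apply: (ideal_sum idN) => i _; apply: vN => //.
  by rewrite mem_enum.
case/(max_prime maxN) => // Np; apply/nNlam/(max_primeX maxN (k := n.+1)).
by rewrite (lam_eps p_prime (zt_sum n R)); exact: (ideal_mulr idN).
Qed.

End UnitResolvent.

(** * Lifting *)

Lemma cyclic_index n (G : finGroupType) : cyclic [set: G] -> #|[set: G]| = n.+2 ->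
  exists (io : G -> 'I_n.+2) (el : 'I_n.+2 -> G),
    [/\ forall x y, io (x * y)%g = io x + io y, cancel el io & cancel io el].
Proof.
case/cyclicP => s Gs; rewrite Gs -orderE => os.
have s_mod k : (s ^+ (k %% n.+2) = s ^+ k)%g by rewrite -os expg_mod_order.
have /boolp.choice[io ioE] x : exists v : 'I_n.+2, (s ^+ v)%g = x.
  have /cycleP[k ->] : x \in <[s]>%g by rewrite -Gs inE.
  by exists (inord (k %% n.+2)); rewrite inordK ?ltn_pmod // s_mod.
pose el (v : 'I_n.+2) := (s ^+ v)%g.
have el_inj : injective el.
  move=> u v /eqP; rewrite eq_expg_mod_order os !modn_small // => /eqP uv.
  exact: val_inj.
have elK : cancel el io by move=> v; apply: el_inj; exact: ioE.
exists io, el; split=> // x y; apply: el_inj.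
by rewrite /el ioE s_mod expgD !ioE.
Qed.

Lemma galois_lift n (G : finGroupType) (R1 R2 : comPzRingType) (g : {rmorphism R1 -> R2})
    (S : galgebra G R2) (io : G -> 'I_n.+2) (el : 'I_n.+2 -> G) :
  prime n.+2 -> (forall x y, io (x * y)%g = io x + io y) ->
  cancel el io -> cancel io el -> (forall y, exists x, g x = y) -> semilocal R2 ->
  (forall z, invertible (g z) -> invertible z) -> galois S ->
  exists S1 : galgebra G R1, galois S1 /\ galgebra_iso (base_change g S1) S.
Proof.
move=> p_prime ioM elK ioK g_surj slR g_unit galS.
have io_inj := can_inj ioK; have io_surj v : exists x, io x = v by exists (el v).
have [y [a2 [sy ya ua2]]] := unit_resolvent p_prime ioM elK ioK galS slR.
have [a1 ga1] := cyc_map_surj g_surj a2.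
(* Any lift of [a2] will do: g reflects units between R' and R'', and the norm transfers this
   property to their extensions by zeta. *)
have ua1 : invertible (1 + (zt - 1) ^+ n.+2 * a1).
  apply/nm_unit/g_unit; rewrite -nm_map rmorphD rmorph1 rmorphM rmorphXn rmorphB rmorph1.
  rewrite cyc_map_zt ga1; case: ua2 => b ab.
  by exists (nm b); rewrite -nmM ab nm1.
have [C CE] := el_cocycle p_prime ua1.
have [C1 CC1] := norm_cocycle_ex C.
pose V := 'I_n.+2 : finZmodType.
pose j : {rmorphism R1 -> S} := galg_in S \o g.
pose w : grpalg (cyc n S) V := elw n zt y.
have Cj : ga_coef (V * V)%type (cyc_map n j) (cc C) =
    1 + ga_scal (as_poly n zt y) * coboundary (beta n zt).
  rewrite CE rmorphD rmorph1 rmorphM ga_coef_scal ga_coef_coboundary.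
  have -> : cyc_map n j a1 = as_poly n zt y.
    by rewrite -ya -ga1; apply: cyc_ext => i; rewrite !cyc_map_co.
  by rewrite (rmorph_beta n (cyc_map_zt n j)).
have sw : splits (ga_coef (V * V)%type (cyc_map n j) (cc C)) w.
  by rewrite Cj; exact: el_splits.
have uw : invertible w.
  by apply: splits_unit sw; apply: invertible_morph; exact: cc_unit.
have [om wom] := gnm_invertible uw.
have som : splits (ga_coef (V * V)%type j (cc C1)) om.
  apply: (gnm_splits sw _ wom); rewrite gnm_map -rmorphM CC1 rmorph1.
  by [].
have act1 : ga_coef V (galg_act S (el 1)) om = ga_mono 1 * om.
  have e1 : ga_coef V (cyc_map n (galg_act S (el 1))) w = ga_mono 1 * w.
    by rewrite (rmorph_elw n (cyc_map_zt n _)) sy el_shift.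
  have := congr1 (@gnm n S V) e1; rewrite gnm_map gnmM gnm_mono => e2.
  have e3 : (ga_mono (1 : V) : grpalg S V) ^+ n.+1 * ga_mono 1 = 1.
    have mX k : (ga_mono (1 : V) : grpalg S V) ^+ k = ga_mono k%:R.
      by elim: k => [|k IHk]; rewrite ?expr0 // exprSr IHk -ga_monoD natr1.
    rewrite -exprSr mX (_ : n.+2%:R = 0 :> V) ?ga_mono0 //.
    by apply: val_inj; rewrite Zp_nat /= modnn.
  have := congr1 (ga_coef V (galg_act S (el 1))) wom; rewrite rmorphM rmorph1.
  rewrite [X in X * _]e2 => e4.
  apply: inverse_unique e4 _.
  by rewrite mulrACA e3 wom mulr1.
have om_act x v : galg_act S x (om v) = om (v - io x).
  have actk (k : nat) : ga_coef V (galg_act S (el k%:R)) om = ga_mono k%:R * om.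
    elim: k => [|k IHk].
      have el0 : el 0 = 1%g by rewrite -[1%g]ioK (io1 ioM).
      by apply/ffunP => u; rewrite ga_coefE ga_monoM mulr0n subr0 el0 galg_act1.
    have -> : ga_coef V (galg_act S (el k.+1%:R)) om =
        ga_coef V (galg_act S (el 1)) (ga_coef V (galg_act S (el k%:R)) om).
      apply/ffunP => u; rewrite !ga_coefE -galg_actM; congr (galg_act S _ _).
      by apply: io_inj; rewrite ioM !elK addrC natr1.
    by rewrite IHk rmorphM ga_coef_mono act1 mulrA -ga_monoD natr1.
  rewrite -ga_coefE -{1}[x]ioK -{1}[io x]natr_Zp actk ga_monoM.
  by rewrite natr_Zp.
exists (twist_galg C1 ioM); split; first exact: twist_galois.
exact: (@twist_base_change_iso R1 R2 g V C1 G io ioM io_inj io_surj S om galS j).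
Qed.

Theorem corollary2p8 (p : nat) (hp : prime p)
    (Cp : finGroupType) (hcyc : cyclic [set: Cp]) (hcard : #|[set: Cp]| = p)
    (R1 R2 : comPzRingType) (g : {rmorphism R1 -> R2})
    (hsurj : forall y : R2, exists x : R1, g x = y)
    (hsemi : semilocal R2)
    (hunit : forall z : R1, invertible (g z) -> invertible z)
    (S2 : galgebra Cp R2) (hS2 : galois S2) :
  exists S1 : galgebra Cp R1, galois S1 /\ galgebra_iso (base_change g S1) S2.
Proof.
case: p hp hcard => [|[|n]] // hp hcard.
have [io [el [ioM elK ioK]]] := cyclic_index hcyc hcard.
exact: galois_lift hp ioM elK ioK hsurj hsemi hunit hS2.
Qed.
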